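(* Let $n\ge1$, $1<p<\infty$, let $\Omega\subset\mathbb R^n$ be a domain, $T>0$ and $\Omega_T=\Omega\times(0,T)$. Let $0<\gamma<1$, $-1<\rho\le\gamma$, $-\rho<\sigma\le\gamma$ and $0<q\le r<\infty$. Then there exist positive constants $c_1$ and $c_2$, depending only on $n,p,q,r,\gamma,\rho,\sigma$, such that for every $f\in L^q_{\mathrm{loc}}(\Omega_T)$ \[ c_1\|f\|_{\mathrm{PBMO}^+_{\gamma,q}(\Omega_T)}\le\|f\|_{\mathrm{PBMO}^+_{\rho,\sigma,r}(\Omega_T)}\le c_2\|f\|_{\mathrm{PBMO}^+_{\gamma,q}(\Omega_T)} , \] where these quantities are allowed to take the value $\infty$.
   Context: Points of $\mathbb R^{n+1}$ are written $(x,t)$ with $x\in\mathbb R^n$, $t\in\mathbb R$; $|E|$ is Lebesgue measure, integrals are with respect to $dx\,dt$, and $⨍_E g=\frac1{|E|}\int_E g$ denotes the integral average. Write $g_+=\max\{g,0\}$, $g_-=-\min\{g,0\}$. A domain is a nonempty open connected set. For $x\in\mathbb R^n$ and $L>0$ let $Q(x,L)=\{y\in\mathbb R^n:|y_i-x_i|\le L,\ i=1,\dots,n\}$. A parabolic rectangle (in the $p$-geometry, $1<p<\infty$ fixed) centered at $(x,t)$ with side length $L>0$ is $R=R(x,t,L)=Q(x,L)\times(t-L^p,t+L^p)$. For $-1<\gamma<1$ its upper and lower parts are $R^+(\gamma)=Q(x,L)\times(t+\gamma L^p,t+L^p)$ and $R^-(\gamma)=Q(x,L)\times(t-L^p,t-\gamma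 L^p)$. For $-1<\gamma<1$, $-\gamma\le\delta<1$ and $0<q<\infty$ set \[ \|f\|_{\mathrm{PBMO}^+_{\gamma,\delta,q}(\Omega_T)}=\sup_{R\subset\Omega_T}\ \inf_{c\in\mathbb R}\Big(⨍_{R^+(\gamma)}(f-c)_+^q+⨍_{R^-(\delta)}(f-c)_-^q\Big)^{1/q}, \] where the supremum is over all parabolic rectangles $R\subset\Omega_T$. For $0\le\gamma<1$ write $\mathrm{PBMO}^+_{\gamma,q}=\mathrm{PBMO}^+_{\gamma,\gamma,q}$. The space $\mathrm{PBMO}^+_{\gamma,\delta,q}(\Omega_T)$ consists of the $f\in L^q_{\mathrm{loc}}(\Omega_T)$ for which this quantity is finite. *)

(* Defs.v *)
From HB Require Import structures.
From mathcomp Require Import all_boot all_order all_algebra.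
From mathcomp Require Import all_classical all_reals all_analysis.

Set Implicit Arguments.
Unset Strict Implicit.
Unset Printing Implicit Defensive.

Import Order.TTheory GRing.Theory Num.Theory.
Import numFieldNormedType.Exports.

Local Open Scope classical_set_scope.
Local Open Scope ring_scope.

Section measurable_rV.
Context {R : realType}.

Definition rV_coor n (i : 'I_n) (x : 'rV[R]_n) : R := x ord0 i.

Definition measure_rV_display : measure_display.
Proof. exact: (measure_tuple_display default_measure_display). Qed.

Section instance.
Variable n : nat.

Let rV_set0 : g_sigma_preimage (@rV_coor n) set0.
Proof. exact: sigma_algebra0. Qed.

Let rV_setC A :
  g_sigma_preimage (@rV_coor n) A -> g_sigma_preimage (@rV_coor n) (~` A).
Proof. exact: sigma_algebraC. Qed.

Let rV_bigcup (F : _^nat) : (forall i, g_sigma_preimage (@rV_coor n) (F i)) ->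
  g_sigma_preimage (@rV_coor n) (\bigcup_i (F i)).
Proof. exact: sigma_algebra_bigcup. Qed.

HB.instance Definition _ := @isMeasurable.Build measure_rV_display
  'rV[R]_n (g_sigma_preimage (@rV_coor n)) rV_set0 rV_setC rV_bigcup.

End instance.

Lemma measurable_rV_coor n (i : 'I_n) : measurable_fun setT (@rV_coor n i).
Proof.
move=> _ Y mY; rewrite setTI; apply: sub_sigma_algebra => /=.
rewrite -bigcup_seq/=; exists i => /=; first by rewrite mem_index_enum.
by exists Y => //; rewrite setTI.
Qed.

Lemma measurable_fun_rVP d (T : measurableType d) n (f : T -> 'rV[R]_n) :
  (forall i, measurable_fun setT (@rV_coor n i \o f)) -> measurable_fun setT f.
Proof.
move=> mf _ A mA; rewrite setTI.
have : preimage_set_system setT f (g_sigma_preimage (@rV_coor n)) (f @^-1` A).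
  by exists A => //; rewrite setTI.
rewrite -g_sigma_preimage_comp; apply: smallest_sub => /=.
  exact: sigma_algebra_measurable.
rewrite -bigcup_seq => B [i _ [C mC <-]].
exact: mf.
Qed.

Definition rV_cons n (p : measurableTypeR R * 'rV[R]_n) : 'rV[R]_n.+1 :=
  row_mx (p.1%:M : 'rV[R]_1) p.2.

Definition rV_uncons n (x : 'rV[R]_n.+1) : measurableTypeR R * 'rV[R]_n :=
  (x ord0 ord0, rsubmx (x : 'rV[R]_(1 + n))).

Lemma rV_cons0 n a (v : 'rV[R]_n) (j : 'I_1) :
  rV_cons (a, v) ord0 (lshift n j) = a.
Proof.
by apply: etrans (row_mxEl _ _ _ _) _; rewrite mxE (ord1 j).
Qed.

Lemma rV_consS n a (v : 'rV[R]_n) (j : 'I_n) :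
  rV_cons (a, v) ord0 (rshift 1 j) = v ord0 j.
Proof. exact: (row_mxEr (a%:M : 'rV[R]_1) v). Qed.

Lemma rV_consK n : cancel (@rV_cons n) (@rV_uncons n).
Proof.
case=> a v; rewrite /rV_uncons; congr (_, _); last exact: row_mxKr.
have -> : ord0 = lshift n (ord0 : 'I_1) :> 'I_n.+1 by exact/val_inj.
exact: rV_cons0.
Qed.

Lemma rV_unconsK n : cancel (@rV_uncons n) (@rV_cons n).
Proof.
move=> x; rewrite /rV_uncons /rV_cons /=.
rewrite -[RHS](hsubmxK (x : 'rV[R]_(1 + n))).
congr (row_mx _ _ : 'rV[R]_(1 + n)).
by apply/rowP => i; rewrite !ord1 !mxE eqxx mulr1n; congr (x _ _); exact/val_inj.
Qed.

Lemma measurable_rV_cons n : measurable_fun setT (@rV_cons n).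
Proof.
apply: measurable_fun_rVP => i; rewrite -(@splitK 1 n i).
case: (fintype.split _) => j /=.
  rewrite (_ : _ \o _ = fst); first exact: measurable_fst.
  apply/funext => -[a v] /=.
  exact: rV_cons0.
rewrite (_ : _ \o _ = @rV_coor n j \o snd).
  apply: measurableT_comp; first exact: measurable_rV_coor.
  exact: measurable_snd.
by apply/funext => -[a v] /=; exact: rV_consS.
Qed.

Lemma measurable_rV_uncons n : measurable_fun setT (@rV_uncons n).
Proof.
apply: measurable_fun_pair; first exact: (@measurable_rV_coor n.+1 ord0).
apply: measurable_fun_rVP => i.
rewrite (_ : _ \o _ = @rV_coor n.+1 (rshift 1 i)).
  exact: measurable_rV_coor.
by apply/funext => x; rewrite /rV_coor /= mxE.
Qed.

End measurable_rV.

Section lebesgue_rV.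
Context {R : realType}.

Lemma product_measure1_sigma_finite d1 d2 (T1 : measurableType d1)
    (T2 : measurableType d2) (m1 : {sigma_finite_measure set T1 -> \bar R})
    (m2 : {sigma_finite_measure set T2 -> \bar R}) :
  sigma_finite setT (m1 \x m2)%E.
Proof.
have /sigma_finiteP[F [TF ndF Foo]] := sigma_finiteT m1.
have /sigma_finiteP[G [TG ndG Goo]] := sigma_finiteT m2.
exists (fun n => F n `*` G n).
  rewrite -setXTT TF TG predeqE => -[x y]; split.
    move=> [/= [n _ Fnx] [k _ Gky]]; exists (maxn n k) => //; split.
    - by move: x Fnx; exact/subsetPset/ndF/leq_maxl.
    - by move: y Gky; exact/subsetPset/ndG/leq_maxr.
  by move=> [n _ []/= ? ?]; split; exists n.
move=> k; have [? ?] := Foo k; have [? ?] := Goo k.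
split; first exact: measurableX.
by rewrite product_measure1E// lte_mul_pinfty// ge0_fin_numE.
Qed.

Section step.
Variables (n : nat) (mu : {sigma_finite_measure set 'rV[R]_n -> \bar R}).

Definition lebesgue_rV_step : set 'rV[R]_n.+1 -> \bar R :=
  pushforward (@lebesgue_measure R \x mu)%E (@rV_cons R n).

Let m := measure_function_pushforward__canonical__measure_function_Measure
  (@lebesgue_measure R \x mu)%E (@measurable_rV_cons R n).

HB.instance Definition _ := isMeasure.Build _ _ _ lebesgue_rV_step
  (measure0 m) (measure_ge0 m) (@measure_semi_sigma_additive _ _ _ m).

Let step_sigma_finite : sigma_finite setT lebesgue_rV_step.
Proof.
have [F TF Foo] := product_measure1_sigma_finite (@lebesgue_measure R) mu.
exists (fun k => @rV_uncons R n @^-1` F k).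
  by rewrite -preimage_bigcup -TF preimage_setT.
move=> k; have [mF Fk] := Foo k; split.
  by rewrite -[X in measurable X]setTI; exact: measurable_rV_uncons.
rewrite /lebesgue_rV_step /pushforward -comp_preimage.
by rewrite (_ : _ \o _ = id) ?preimage_id//; apply/funext; exact: rV_consK.
Qed.

HB.instance Definition _ :=
  Measure_isSigmaFinite.Build _ _ _ lebesgue_rV_step step_sigma_finite.

End step.

Fixpoint lebesgue_rV n : {sigma_finite_measure set 'rV[R]_n -> \bar R} :=
  if n is m.+1 then lebesgue_rV_step (lebesgue_rV m) else \d_(0 : 'rV[R]_0).

Lemma lebesgue_rV_box n (A : 'I_n -> set (measurableTypeR R)) :
  (forall i, measurable (A i)) ->
  lebesgue_rV n [set x : 'rV[R]_n | forall i, A i (x ord0 i)] =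
  (\prod_(i < n) lebesgue_measure (A i))%E.
Proof.
elim: n A => [|n IHn] A mA.
  by rewrite big_ord0 /= diracE mem_set//= => -[].
rewrite big_ord_recl -IHn; last by move=> i; exact: mA.
rewrite -product_measure1E //; last first.
  rewrite (_ : mkset _ = \bigcap_(i in [set: 'I_n])
      (@rV_coor R n i @^-1` A (lift ord0 i))).
    apply: fin_bigcap_measurable => // i _.
    rewrite -[X in measurable X]setTI.
    exact: (@measurable_rV_coor R n i measurableT _ (mA (lift ord0 i))).
  by apply/seteqP; split => [x Ax i _|x Ax i]; [exact: Ax|exact: Ax].
have E0 : ord0 = lshift n (ord0 : 'I_1) :> 'I_n.+1 by exact/val_inj.
have ES (j : 'I_n) : lift ord0 j = rshift 1 j by exact/val_inj.
rewrite /= /lebesgue_rV_step /pushforward.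
congr product_measure1; apply/seteqP; split => -[a v] /=.
- move=> H; split=> [|i].
    by have := H ord0; rewrite {2}E0 rV_cons0.
  by have := H (lift ord0 i); rewrite {2}ES rV_consS.
- move=> [Aa Av] i; case: (unliftP ord0 i) => [j|] ->.
    by rewrite {2}ES rV_consS; exact: Av.
  by rewrite {2}E0 rV_cons0.
Qed.
End lebesgue_rV.

Section spacetime.
Context {R : realType} (n : nat).

(* The product of the Borel measures above is completed, so that measurability
   below means Lebesgue measurability. *)
Definition borel_spacetime : set ('rV[R]_n * measurableTypeR R) -> \bar R :=
  (lebesgue_rV n \x @lebesgue_measure R)%E.

HB.instance Definition _ := Measure.on borel_spacetime.

(* [spacetime] is a copy of ['rV[R]_n * R] whose measurable sets are the
   Lebesgue measurable ones; topological notions are those of ['rV[R]_n * R]. *)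
Definition spacetime := caratheodory_type (borel_spacetime^*)%mu.

HB.instance Definition _ := Measurable.on spacetime.

Definition lebesgue_spacetime : set spacetime -> \bar R :=
  @completed_measure_extension _ _ _ borel_spacetime.

HB.instance Definition _ := Measure.on lebesgue_spacetime.

End spacetime.
Arguments spacetime : clear implicits.

Section PBMO.
Context {R : realType} {n : nat}.
Implicit Types (x : 'rV[R]_n) (t L p q gamma delta T : R)
  (f : 'rV[R]_n * R -> R) (Omega : set 'rV[R]_n) (D E : set ('rV[R]_n * R)).

Local Notation mu := (@lebesgue_spacetime R n).

Definition domain Omega := [/\ Omega !=set0, open Omega & connected Omega].

Definition cylinder Omega T : set ('rV[R]_n * R) := Omega `*` `]0, T[%classic.

Definition Lq_loc q D f :=
  measurable_fun (D : set (spacetime R n)) (f : spacetime R n -> R) /\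
  forall K : set ('rV[R]_n * R), compact K -> K `<=` D ->
    (\int[mu]_(z in K) (`|f z| `^ q)%:E < +oo)%E.

Definition cube x L : set 'rV[R]_n :=
  [set y | forall i, `|y ord0 i - x ord0 i| <= L].

Definition prect p x t L : set ('rV[R]_n * R) :=
  cube x L `*` `]t - L `^ p, t + L `^ p[%classic.

Definition prect_up p gamma x t L : set ('rV[R]_n * R) :=
  cube x L `*` `]t + gamma * L `^ p, t + L `^ p[%classic.

Definition prect_low p gamma x t L : set ('rV[R]_n * R) :=
  cube x L `*` `]t - L `^ p, t - gamma * L `^ p[%classic.

Definition average E (g : 'rV[R]_n * R -> \bar R) : \bar R :=
  ((mu E)^-1 * \int[mu]_(z in E) g z)%E.

Definition PBMO_osc p gamma delta q f x t L : \bar R :=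
  ereal_inf [set
    ((average (prect_up p gamma x t L)
        (fun z => ((fun w => f w - c)^\+ z `^ q)%:E) +
      average (prect_low p delta x t L)
        (fun z => ((fun w => f w - c)^\- z `^ q)%:E)) `^ q^-1)%E
    | c in [set: R]].

Definition PBMO2_norm p gamma delta q D f : \bar R :=
  ereal_sup [set u | exists x t L,
    [/\ 0 < L, prect p x t L `<=` D & u = PBMO_osc p gamma delta q f x t L]].

Definition PBMO_norm p gamma q D f : \bar R := PBMO2_norm p gamma gamma q D f.

End PBMO.

(* Main.v *)
Require Import Defs.
From mathcomp Require Import all_boot all_order all_algebra.
From mathcomp Require Import all_classical all_reals all_analysis.
From mathcomp Require Import measurable_realfun ring lra.
Import Order.TTheory GRing.Theory Num.Theory.
Import numFieldNormedType.Exports.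
Local Open Scope classical_set_scope.
Local Open Scope ring_scope.

(** Normalise the norm to 1, so that every rectangle has a constant from which [f]
    deviates, above on the upper part and below on the lower part, only on small
    proportions. If the upper part of a rectangle overlaps the lower part of
    another one, the constant of the second exceeds that of the first by at most a
    fixed amount. Inside one upper part, subdivide into cells, each at the top of
    the upper part of its own rectangle, and stop at the maximal cells whose
    constants exceed the initial one by [A]. On most of the lower parts of the
    stopped rectangles [f] exceeds the initial constant by [A / 2], so these lower
    parts have small total measure, and a Vitali selection among them bounds the
    measure of the stopped cells. Parents of stopped cells are not stopped, so the
    estimate iterates and gives exponential decay of the level sets, hence all
    moments; outside the stopped cells a density argument applies. The time lag
    is shortened by chaining through small rectangles: as [p > 1], a chain crossing
    the cube horizontally takes arbitrarily little time. Lower parts are treated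
    by reversing time and the sign of [f]. Conversely, the parts for [gamma] are
    contained in those for [rho] and [sigma], with comparable measure, and
    [q <= r]. *)

Set Implicit Arguments.
Unset Strict Implicit.

(** * Boxes in space-time *)

(** The comparison of centres is one-sided: it bounds the centre of a later rectangle from above by
    that of an earlier one, never conversely. A single constant must nevertheless serve both the
    upper and the lower part of the given rectangle. It is taken from a small rectangle at relative
    height [(rho - sigma) / 2]: chains lead from it forward to the cells of the upper part and,
    after reversal, to those of the lower part. Both gaps have relative length [(rho + sigma) / 2],
    positive because [- rho < sigma]. A chain of about [N] rectangles of side [L / N] takes time of
    order [N^(1-p) L^p], which fits into the gap for large [N]. Stopped cells are counted through
    their lower parts, since only there does a large centre force [f] to be large. The norm may
    vanish and the infimum over constants need not be attained, so [f] is divided by an arbitrary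
    [M] strictly above the norm. *)

Section level_sets.
Context d (T : measurableType d) (R : realType).

Lemma measurable_superlevel (D : set T) (u : T -> R) (a : R) :
  measurable D -> measurable_fun D u -> measurable (D `&` [set z | a < u z]).
Proof.
move=> mD mu; rewrite [X in measurable X](_ : _ = D `&` u @^-1` `]a, +oo[).
  exact: mu.
by apply/seteqP; split => z; rewrite /= in_itv /= andbT.
Qed.

Lemma measurable_superlevelT (u : T -> R) (a : R) :
  measurable_fun setT u -> measurable [set z | a < u z].
Proof. by move=> mu; rewrite -[X in measurable X]setTI; exact: measurable_superlevel. Qed.

Lemma measurable_sublevelT (u : T -> R) (a : R) :
  measurable_fun setT u -> measurable [set z | u z < a].
Proof.
move=> mu; rewrite [X in measurable X](_ : _ = setT `&` u @^-1` `]-oo, a[).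
  exact: mu.
by rewrite setTI; apply/seteqP; split => z; rewrite /= in_itv.
Qed.

End level_sets.

Section spacetime_boxes.
Context {R : realType} {n : nat}.
Local Notation ST := ('rV[R]_n * R)%type.
Local Notation mu := (@lebesgue_spacetime R n).
Local Notation borel := (@borel_spacetime R n).
Local Notation BT := ('rV[R]_n * measurableTypeR R)%type.

Lemma borel_measurable_spacetime (A : set BT) :
  measurable A -> measurable (A : set (spacetime R n)).
Proof. by move=> mA; apply: sub_caratheodory; exact: sub_sigma_algebra. Qed.

Lemma lebesgue_spacetime_borel (A : set BT) :
  measurable A -> mu A = borel A.
Proof.
by move=> mA; rewrite /lebesgue_spacetime /completed_measure_extension measurable_mu_extE.
Qed.

Definition box (A : 'I_n -> set R) (B : set R) : set ST :=
  [set z : ST | (forall i, A i (z.1 ord0 i)) /\ B z.2].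

Lemma measurable_rV_box (A : 'I_n -> set (measurableTypeR R)) :
  (forall i, measurable (A i)) ->
  measurable [set x : 'rV[R]_n | forall i, A i (x ord0 i)].
Proof.
move=> mA.
rewrite (_ : mkset _ = \bigcap_(i in [set: 'I_n]) (@rV_coor R n i @^-1` A i)).
  apply: fin_bigcap_measurable => // i _.
  rewrite -[X in measurable X]setTI.
  exact: (@measurable_rV_coor R n i measurableT _ (mA i)).
by apply/seteqP; split => [x Ax i _|x Ax i]; exact: Ax.
Qed.

Lemma borel_measurable_box (A : 'I_n -> set (measurableTypeR R))
    (B : set (measurableTypeR R)) :
  (forall i, measurable (A i)) -> measurable B -> measurable (box A B : set BT).
Proof.
move=> mA mB.
rewrite (_ : box A B = [set x : 'rV[R]_n | forall i, A i (x ord0 i)] `*` B) //.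
by apply: measurableX => //; exact: measurable_rV_box.
Qed.

Lemma lebesgue_box (A : 'I_n -> set (measurableTypeR R))
    (B : set (measurableTypeR R)) :
  (forall i, measurable (A i)) -> measurable B ->
  mu (box A B) = ((\prod_(i < n) lebesgue_measure (A i)) * lebesgue_measure B)%E.
Proof.
move=> mA mB; rewrite lebesgue_spacetime_borel; last exact: borel_measurable_box.
rewrite -lebesgue_rV_box // /borel_spacetime -product_measure1E //.
exact: measurable_rV_box.
Qed.

(* Time is reversed when [s = true]; thus lower parts become upper parts. *)
Definition otime (s : bool) (t : R) : R := if s then - t else t.

Definition slab s (x : 'rV[R]_n) l a b : set ST :=
  [set z : ST | cube x l z.1 /\ a < otime s z.2 < b].

(** Half-open in every direction, so that the cells of a subdivision are exactly disjoint and cover.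
    A cell differs from the slab with the same data by a null set. *)
Definition cell s (x : 'rV[R]_n) l a b : set ST :=
  [set z : ST | (forall i, x ord0 i - l <= z.1 ord0 i < x ord0 i + l) /\
           a <= otime s z.2 < b].

Lemma slabE s x l a b : slab s x l a b =
  box (fun i => `[x ord0 i - l, x ord0 i + l]%classic)
      (if s then `]- b, - a[%classic else `]a, b[%classic).
Proof.
apply/seteqP; split => -[y t]; rewrite /slab /box /cube /=.
  move=> [H1 H2]; split=> [i|].
    by have := H1 i; rewrite ler_norml in_itv/= => ?; lra.
  by case: s H2; rewrite /= in_itv/= => ?; lra.
move=> [H1 H2]; split=> [i|].
  by have := H1 i; rewrite ler_norml in_itv/= => ?; lra.
by case: s H2; rewrite /= in_itv/= => ?; lra.
Qed.

Lemma cellE s x l a b : cell s x l a b =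
  box (fun i => `[x ord0 i - l, x ord0 i + l[%classic)
      (if s then `]- b, - a]%classic else `[a, b[%classic).
Proof.
apply/seteqP; split => -[y t]; rewrite /cell /box /=.
  move=> [H1 H2]; split=> [i|]; first by have := H1 i; rewrite in_itv.
  by case: s H2; rewrite /= in_itv/= => ?; lra.
move=> [H1 H2]; split=> [i|]; first by have := H1 i; rewrite in_itv.
by case: s H2; rewrite /= in_itv/= => ?; lra.
Qed.

Lemma lebesgue_itv_len (bl br : bool) (a b : R) : a <= b ->
  lebesgue_measure ([set` Interval (BSide bl a) (BSide br b)] : set (measurableTypeR R))
  = (b - a)%:E.
Proof.
move=> ab; rewrite lebesgue_measure_itv /= lte_fin; case: ltP => // ba.
have -> : a = b by apply/eqP; rewrite eq_le ab ba.
by rewrite subrr.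
Qed.

Lemma borel_measurable_cell s x l a b : measurable (cell s x l a b : set BT).
Proof.
rewrite cellE; apply: borel_measurable_box => [i|]; first exact: measurable_itv.
by case: s; exact: measurable_itv.
Qed.

Lemma borel_measurable_slab s x l a b : measurable (slab s x l a b : set BT).
Proof.
rewrite slabE; apply: borel_measurable_box => [i|]; first exact: measurable_itv.
by case: s; exact: measurable_itv.
Qed.

Lemma measurable_cell s x l a b : measurable (cell s x l a b : set (spacetime R n)).
Proof. apply: borel_measurable_spacetime; exact: borel_measurable_cell. Qed.

Lemma measurable_slab s x l a b : measurable (slab s x l a b : set (spacetime R n)).
Proof. apply: borel_measurable_spacetime; exact: borel_measurable_slab. Qed.

Lemma lebesgue_slab s x l a b : 0 <= l -> a <= b ->
  mu (slab s x l a b) = ((2 * l) ^+ n * (b - a))%:E.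
Proof.
move=> l0 ab; rewrite slabE lebesgue_box; last 2 first.
- by move=> i; exact: measurable_itv.
- by case: s; exact: measurable_itv.
rewrite (eq_bigr (fun=> (2 * l)%:E)); last first.
  by move=> i _; rewrite lebesgue_itv_len; [congr EFin; lra|lra].
rewrite prodEFin prodr_const card_ord.
by case: s; (rewrite lebesgue_itv_len; last lra); rewrite -EFinM; congr (_ * _)%:E; lra.
Qed.

Lemma lebesgue_cell s x l a b : 0 <= l -> a <= b ->
  mu (cell s x l a b) = ((2 * l) ^+ n * (b - a))%:E.
Proof.
move=> l0 ab; rewrite cellE lebesgue_box; last 2 first.
- by move=> i; exact: measurable_itv.
- by case: s; exact: measurable_itv.
rewrite (eq_bigr (fun=> (2 * l)%:E)); last first.
  by move=> i _; rewrite lebesgue_itv_len; [congr EFin; lra|lra].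
rewrite prodEFin prodr_const card_ord.
by case: s; (rewrite lebesgue_itv_len; last lra); rewrite -EFinM; congr (_ * _)%:E; lra.
Qed.

End spacetime_boxes.

(** * Outer regularity *)

Lemma measure_bigcap_lt d (T : measurableType d) (R : realType)
    (nu : {measure set T -> \bar R}) (F : (set T)^nat) (e : \bar R) :
  (nu (F 0%N) < +oo)%E -> (forall k, measurable (F k)) ->
  (forall k, F k.+1 `<=` F k) -> (nu (\bigcap_k F k) < e)%E ->
  exists k, (nu (F k) < e)%E.
Proof.
move=> F0 mF dF; apply: contraPP => /forallNP He.
have {}He k : (e <= nu (F k))%E by rewrite leNgt; apply/negP; exact: He.
have ndF : {homo F : n m / (n <= m)%N >-> (m <= n)%O}.
  by apply: (@homo_leq _ F (fun A B => (B <= A)%O)) => //;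
    [move=> ? ? ? /[swap]; exact: le_trans|move=> k; exact/subsetPset].
have mI : measurable (\bigcap_k F k) by exact: bigcapT_measurable.
have cF := nonincreasing_cvg_mu F0 mF mI ndF.
apply/negP; rewrite -leNgt -(cvg_lim _ cF) //.
by apply: lime_ge; [exact: cvgP cF|exact: nearW].
Qed.

Section regularity.
Context {R : realType} {n : nat}.
Local Notation ST := ('rV[R]_n * R)%type.
Local Notation mu := (@lebesgue_spacetime R n).
Local Notation borel := (@borel_spacetime R n).
Local Notation BT := ('rV[R]_n * measurableTypeR R)%type.

(** Openness in coordinates, the form in which a small enough cell around a point is seen to stay
    inside the set. *)
Definition coord_open (O : set ST) := forall z, O z -> exists2 e : R, 0 < e &
  forall w : ST, (forall i, `|w.1 ord0 i - z.1 ord0 i| < e) ->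
    `|w.2 - z.2| < e -> O w.

Lemma borel_measurable_coord_open O : coord_open O -> measurable (O : set BT).
Proof.
move=> oO.
pose C (k : 'rV[rat]_n * rat * nat) : set ST :=
  box (fun i => `]ratr (k.1.1 ord0 i) - k.2.+1%:R^-1,
                  ratr (k.1.1 ord0 i) + k.2.+1%:R^-1[%classic)
      `]ratr k.1.2 - k.2.+1%:R^-1, ratr k.1.2 + k.2.+1%:R^-1[%classic.
rewrite (_ : O = \bigcup_k (if pselect (C k `<=` O) then C k else set0)).
  apply: countable_bigcupT_measurable => [|k]; first exact: countableP.
  case: pselect => [_|_] /=; last exact: measurable0.
  by apply: borel_measurable_box => *; exact: measurable_itv.
apply/seteqP; split => [z Oz|z [k _]]; last by case: pselect => // CO; exact: CO.
have [e e0 eO] := oO z Oz.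
(* A rational box of half-width [h] with centre within [h] of [z] contains [z] and stays within
   [2 * h < e] of it. *)
have [m] : exists m : nat, 0 + m.+1%:R^-1 < e / 2.
  by apply: ltr_add_invr; rewrite divr_gt0.
rewrite add0r; set h : R := m.+1%:R^-1 => hm.
have h0 : 0 < h by rewrite invr_gt0.
have approx (y : R) : exists q : rat, y - h < ratr q < y + h.
  have [|q] := @rat_in_itvoo R (y - h) (y + h); first lra.
  by rewrite in_itv; exists q.
have /choice[q qP] : forall i, exists q : rat, z.1 ord0 i - h < ratr q < z.1 ord0 i + h.
  by move=> i; exact: approx.
have [q' q'P] := approx z.2.
exists (\row_i q i, q', m) => //; case: pselect => [?|[]] /=.
  rewrite /C /box /= -/h; split=> [i|]; rewrite in_itv /= ?mxE.
    by have := qP i; lra.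
  by move: q'P; lra.
move=> w; rewrite /C /box /= -/h in_itv /= => -[wq1 wq2]; apply: eO => [i|].
  have := wq1 i; rewrite in_itv /= mxE ltr_norml => ?.
  by have := qP i; lra.
by rewrite ltr_norml; move: q'P; lra.
Qed.

Lemma coord_open_bigcup (I : Type) (F : I -> set ST) :
  (forall i, coord_open (F i)) -> coord_open (\bigcup_i F i).
Proof.
move=> oF z [i _ Fz]; have [e e0 eF] := oF i z Fz.
by exists e => // w w1 w2; exists i => //; exact: eF.
Qed.

Lemma coord_open_setI (A B : set ST) :
  coord_open A -> coord_open B -> coord_open (A `&` B).
Proof.
move=> oA oB z [Az Bz]; have [e e0 eA] := oA z Az; have [d d0 dB] := oB z Bz.
exists (Num.min e d); first by rewrite lt_min e0.
move=> w w1 w2; split.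
  by apply: eA => [i|]; [have := w1 i|move: w2]; rewrite lt_min => /andP[].
by apply: dB => [i|]; [have := w1 i|move: w2]; rewrite lt_min => /andP[].
Qed.

Lemma coord_openT : coord_open setT.
Proof. by move=> z _; exists 1. Qed.

Lemma coord_open_cylinder (Omega : set 'rV[R]_n) (T : R) :
  open Omega -> coord_open (cylinder Omega T).
Proof.
move=> oO [x t] [/= Ox]; rewrite in_itv /= => /andP[t0 tT].
have /nbhs_ballP[e /= e0 eO] := open_nbhs_nbhs (conj oO Ox).
exists (Num.min e (Num.min t (T - t))).
  by rewrite !lt_min e0 t0 subr_gt0.
move=> [y s] /= h1; rewrite !lt_min !ltr_norml => /and3P[h2 h3 h4]; split => /=.
  apply: eO; split=> // i j; rewrite ord1 /ball /= distrC.
  by have := h1 j; rewrite lt_min => /andP[].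
by rewrite in_itv /=; lra.
Qed.

Section bounded.
Variables (bor : {measure set BT -> \bar R}) (D : set BT).
Hypothesis mD : measurable D.
Hypothesis D_fin : (bor D < +oo)%E.
Let nu : {measure set BT -> \bar R} := mrestr bor mD.

Let nu_fin A : measurable A -> (nu A < +oo)%E.
Proof.
move=> mA; apply: le_lt_trans D_fin; rewrite /nu /= /mrestr.
by apply: le_measure; rewrite ?inE; [exact: measurableI|exact: mD|exact: subIsetr].
Qed.

(** Approximation from outside and inside at once makes the property stable under complement, so the
    regular sets form a sigma-algebra. *)
Let regular (A : set BT) := forall e : R, 0 < e -> exists O F : set BT,
  [/\ coord_open O, coord_open (~` F), F `<=` A, A `<=` O & (nu (O `\` F) < e%:E)%E].

Let mclosed (F : set BT) : coord_open (~` F) -> measurable F.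
Proof.
by move=> oF; rewrite -(setCK F); apply: measurableC; exact: borel_measurable_coord_open.
Qed.

Let regular_setC A : regular A -> regular (~` A).
Proof.
move=> rA e e0; have [ O [F [oO oF FA AO ltOF]]] := rA e e0.
exists (~` F), (~` O); split; rewrite ?setCK //.
- exact: subsetC.
- exact: subsetC.
- by rewrite setDE setCK setIC -setDE.
Qed.

(** A countable union of closed sets need not be closed, so the inner set is a finite union.
    Continuity from above, valid as [nu] is finite, makes the loss small. *)
Let regular_bigcup (A : (set BT)^nat) :
  (forall k, regular (A k)) -> regular (\bigcup_k A k).
Proof.
move=> rA e e0.
have /choice[ O /choice[F OF]] : forall k, exists O, exists F : set BT,
    [/\ coord_open O, coord_open (~` F), F `<=` A k, A k `<=` O &
    (nu (O `\` F) < (e / 2 / (2 ^ k.+1)%:R)%:E)%E].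
  by move=> k; apply: rA; rewrite !divr_gt0 // ltr0n expn_gt0.
have oO k : coord_open (O k) by case: (OF k).
have oF k : coord_open (~` F k) by case: (OF k).
pose G k := \bigcup_k O k `\` \bigcup_(i < k) F i.
have oG k : coord_open (~` \bigcup_(i < k) F i).
  elim: k => [|k IH]; first by rewrite bigcup0 ?setC0; [exact: coord_openT|].
  rewrite bigcup_mkord big_ord_recr /= setCU -bigcup_mkord.
  exact: coord_open_setI.
have mO : measurable (\bigcup_k O k : set BT).
  apply: bigcup_measurable => k _; exact: borel_measurable_coord_open.
have mG k : measurable (G k : set BT).
  by apply: measurableD => //; exact: mclosed.
have [k Gk] : exists k, (nu (G k) < e%:E)%E.
  apply: measure_bigcap_lt => //; first exact: nu_fin (mG 0%N).
    move=> k z [Oz nF]; split=> // -[i /= ik Fz]; apply: nF; exists i => //=.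
    exact: ltn_trans ik _.
  apply: (@le_lt_trans _ _ (e / 2)%:E); last by rewrite lte_fin; lra.
  apply: le_trans (epsilon_trick0 xpredT _); last by rewrite divr_ge0 // ltW.
  apply: (@le_trans _ _ (\sum_(k <oo) nu (O k `\` F k))%E); last first.
    by apply: lee_nneseries => // k _; apply: ltW; case: (OF k).
  apply: measure_sigma_subadditive.
  - move=> k; apply: measurableD; last exact: mclosed.
    exact: borel_measurable_coord_open.
  - by apply: bigcapT_measurable.
  - move=> z Gz; have [[i _ Oz] _] := Gz 0%N I; exists i => //; split=> // Fz.
    by have [_] := Gz i.+1 I; apply; exists i => //=.
exists (\bigcup_k O k), (\bigcup_(i < k) F i); split=> //.
- exact: coord_open_bigcup.
- by move=> z [i _ Fz]; exists i => //; case: (OF i) => _ _ + _ _; apply.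
- by move=> z [i _ Fz]; exists i => //; case: (OF i) => _ _ _ + _; apply.
Qed.

Let regular0 : regular set0.
Proof.
move=> e e0; exists set0, set0; split => //.
- by rewrite setC0; exact: coord_openT.
- by rewrite setD0 measure0 lte_fin.
Qed.

Let regular_setI A B : regular A -> regular B -> regular (A `&` B).
Proof.
move=> rA rB; rewrite -(setCK (A `&` B)) setCI; apply: regular_setC.
rewrite -bigcup2E; apply: regular_bigcup => -[|[|k]] /=.
- exact: regular_setC.
- exact: regular_setC.
- exact: regular0.
Qed.

Let regular_smallest (T : Type) (phi : BT -> T) (G : set (set T)) :
  (forall A, G A -> regular (phi @^-1` A)) ->
  forall A, <<s G >> A -> regular (phi @^-1` A).
Proof.
move=> rG A; suff sub : <<s G >> `<=` [set A | regular (phi @^-1` A)] by exact: sub.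
apply: smallest_sub => //; split => [|B|B].
- by rewrite /= preimage_set0.
- by rewrite /= setTD preimage_setC; exact: regular_setC.
- by rewrite /= preimage_bigcup; exact: regular_bigcup.
Qed.

(** For a continuous [phi] the preimage of an open half-line is open and is the increasing union of
    the closed preimages of [[x + 1/(k+1), +oo[]; half-lines generate the Borel sets. *)
Let regular_coord (phi : BT -> R) :
  (forall (z : ST) (e : R), 0 < e -> exists2 d : R, 0 < d & forall w : ST,
    (forall i, `|w.1 ord0 i - z.1 ord0 i| < d) -> `|w.2 - z.2| < d ->
    `|phi w - phi z| < e) ->
  forall A : set (measurableTypeR R), measurable A -> regular (phi @^-1` A).
Proof.
move=> cphi A mA.
have {mA} : <<s @measurable_realfun.RGenOInfty.G R >> A by rewrite -[X in X A]measurable_realfun.RGenOInfty.measurableE.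
apply: regular_smallest => {}A [x ->] e e0.
have op (a : R) : coord_open (phi @^-1` `]a, +oo[).
  move=> z; rewrite /= in_itv /= andbT => az.
  have [d d0 dP] := cphi z (phi z - a) ltac:(lra).
  exists d => // w w1 w2; rewrite in_itv /= andbT.
  by have := dP w w1 w2; rewrite ltr_norml; lra.
have opC (a : R) : coord_open (~` (phi @^-1` `[a, +oo[)).
  move=> z; rewrite /= in_itv /= andbT => /negP; rewrite -ltNge => az.
  have [d d0 dP] := cphi z (a - phi z) ltac:(lra).
  exists d => // w w1 w2 /=; rewrite in_itv /= andbT; apply/negP; rewrite -ltNge.
  by have := dP w w1 w2; rewrite ltr_norml; lra.
pose F k := phi @^-1` `[x + k.+1%:R^-1, +oo[.
have [k Fk] : exists k, (nu (phi @^-1` `]x, +oo[ `\` F k) < e%:E)%E.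
  have mF k : measurable (phi @^-1` `]x, +oo[ `\` F k).
    apply: measurableD; first exact: borel_measurable_coord_open.
    by apply: mclosed; exact: opC.
  apply: measure_bigcap_lt => //; first exact: nu_fin (mF 0%N).
    move=> k z [xz Fz]; split=> // Fz'; apply: Fz; move: Fz'.
    rewrite /F /= !in_itv /= !andbT; apply: le_trans.
    by rewrite lerD2l lef_pV2 ?posrE ?ltr0n // ler_nat.
  rewrite (_ : bigcap _ _ = set0) ?measure0 ?lte_fin //.
  apply/seteqP; split => // z Gz; have [xz _] := Gz 0%N I.
  move: xz; rewrite /= in_itv /= andbT => /ltr_add_invr[k xk].
  have [_] := Gz k I; apply; rewrite /F /= in_itv /= andbT; exact: ltW.
exists (phi @^-1` `]x, +oo[), (F k); split => //.
- exact: opC.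
- move=> z; rewrite /F /= !in_itv /= !andbT; move=> xz; apply: lt_le_trans xz.
  by rewrite ltrDl invr_gt0.
Qed.

Lemma borel_outer_regular (A : set BT) (e : R) : measurable A -> 0 < e ->
  exists O : set BT, [/\ coord_open O, A `<=` O & (bor (O `&` D) < bor (A `&` D) + e%:E)%E].
Proof.
move=> mA e0; have rA : regular A.
  move: mA; rewrite measurable_prod_measurableType => mA.
  rewrite -(preimage_id A); move: A mA; apply: regular_smallest => _ [A mA [B mB <-]].
  rewrite preimage_id (_ : A `*` B = (fst @^-1` A) `&` (snd @^-1` B)) //.
  apply: regular_setI; last first.
    by apply: (regular_coord (phi := snd)) => // z d d0; exists d.
  apply: (regular_smallest _ mA) => A'; rewrite -bigcup_seq => -[i _ [C mC <-]].
  rewrite setTI -comp_preimage.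
  by apply: regular_coord => // z d d0; exists d => // w w1 _; exact: w1.
have [ O [F [oO oF FA AO ltOF]]] := rA e e0.
have mF := mclosed oF; have mO := borel_measurable_coord_open oO.
exists O; split => //.
have -> : O `&` D = (F `&` D) `|` ((O `\` F) `&` D).
  rewrite -setIUl setDUK //; exact: subset_trans AO.
rewrite measureU; [|exact: measurableI|by apply: measurableI => //; exact: measurableD|]; last first.
  by apply/seteqP; split => // z [[? ?] [[? ?] ?]].
apply: lee_ltD => //; last first.
  apply: le_measure; rewrite ?inE; [exact: measurableI|exact: measurableI|].
  exact: setSI.
rewrite ge0_fin_numE //; apply: le_lt_trans (nu_fin mA).
by apply: le_measure; rewrite ?inE; [exact: measurableI|exact: measurableI|exact: setSI].
Qed.

End bounded.

(** The measure [mu] is an infimum over countable Borel covers. Half of [e] pays for the choice of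
    the cover, half for enlarging its union to an open set. *)
Lemma lebesgue_outer_regular (D : set BT) (E : set (spacetime R n)) (e : R) :
  measurable D -> (borel D < +oo)%E -> E `<=` D -> 0 < e -> exists O : set ST,
  [/\ coord_open O, measurable (O : set (spacetime R n)), E `<=` O & (mu (O `&` D) <= mu E + e%:E)%E].
Proof.
move=> mD D_fin ED e0.
have muE_fin : mu E \is a fin_num.
  rewrite ge0_fin_numE ?mu_ext_ge0 //; apply: le_lt_trans D_fin.
  rewrite -lebesgue_spacetime_borel //; exact: le_mu_ext.
have e20 : 0 < e / 2 by rewrite divr_gt0.
have [_ [C [mC EC] <-] ltC] := lb_ereal_inf_adherent e20 muE_fin.
have mUC : measurable (\bigcup_k C k) by exact: bigcup_measurable.
have [ O [oO CO ltO]] := borel_outer_regular mD D_fin mUC e20.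
have mO := borel_measurable_coord_open oO.
exists O; split => //.
- exact: borel_measurable_spacetime.
- exact: subset_trans CO.
rewrite lebesgue_spacetime_borel; last exact: measurableI.
apply: le_trans (ltW ltO) _; rewrite [e in leRHS]splitr EFinD addeA leeD2r //.
apply: le_trans (ltW ltC).
apply: le_trans (measure_sigma_subadditive _ _ _ _) => //.
- exact: measurableI.
Qed.

End regularity.

(** * Subdivision trees *)

Lemma measure_bigcup_le d (T : measurableType d) (R : realType)
    (nu : {measure set T -> \bar R}) (F : (set T)^nat) (M : \bar R) :
  (forall k, measurable (F k)) -> (forall k, F k `<=` F k.+1) ->
  (forall k, nu (F k) <= M)%E -> (nu (\bigcup_k F k) <= M)%E.
Proof.
move=> mF iF FM; have mUF : measurable (\bigcup_k F k) by exact: bigcup_measurable.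
have ndF : {homo F : k m / (k <= m)%N >-> (k <= m)%O}.
  by apply: homo_leq => // [? ? ?|k]; [exact: le_trans|exact/subsetPset].
have cF := nondecreasing_cvg_mu (mu := nu) mF mUF ndF.
by rewrite -(cvg_lim _ cF) //; apply: lime_le; [exact: cvgP cF|exact: nearW].
Qed.

Section finite_unions.
Context d (T : measurableType d) (R : realType) (mu : {measure set T -> \bar R}).

Lemma measure_bigsetU_le (I : Type) (s : seq I) (P : pred I) (F : I -> set T) :
  (forall i, P i -> measurable (F i)) ->
  (mu (\big[setU/set0]_(i <- s | P i) F i) <= \sum_(i <- s | P i) mu (F i))%E.
Proof.
move=> mF; elim: s => [|i s IH]; first by rewrite !big_nil measure0.
rewrite !big_cons; case: ifPn => // Pi.
apply: le_trans (measureU2 _ _ _) _; [exact: mF|exact: bigsetU_measurable|].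
exact: leeD2l.
Qed.

Lemma sum_measure_disjoint_le (I : choiceType) (s : seq I) (F : I -> set T) (G : set T) :
  measurable G -> (forall i, measurable (F i)) -> (forall i, i \in s -> F i `<=` G) ->
  uniq s -> {in s &, forall i j, F i `&` F j !=set0 -> i = j} ->
  (\sum_(i <- s) mu (F i) <= mu G)%E.
Proof.
move=> mG mF FG us dF.
have mU : measurable (\big[setU/set0]_(i <- s) F i) by exact: bigsetU_measurable.
rewrite (_ : \sum_(i <- s) mu (F i) = mu (\big[setU/set0]_(i <- s) F i))%E.
  apply: le_measure; rewrite ?inE //.
  by rewrite -bigcup_seq => z [i /FG]; apply.
elim: s us dF {FG mU} => [|i s IH] /=; first by rewrite !big_nil measure0.
move=> /andP[nis us] dF; rewrite !big_cons measureU //.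
- by rewrite IH // => j k js ks; apply: dF; rewrite inE ?js ?ks orbT.
- exact: bigsetU_measurable.
- apply/seteqP; split => // z []; rewrite -bigcup_seq => Fi [j /= js Fj].
  suff ij : i = j by rewrite ij js in nis.
  by apply: dF; rewrite ?inE ?eqxx ?js ?orbT //; exists z.
Qed.

End finite_unions.

Section subdivision_tree.
Context d (T : measurableType d) (R : realType) (mu : {measure set T -> \bar R}).
Variables (C : choiceType) (U : C -> set T) (children : C -> seq C) (wf : C -> Prop).
Hypothesis mU : forall c, measurable (U c).
Hypothesis wf_children : forall c e, wf c -> e \in children c -> wf e.
Hypothesis children_cover : forall c z, wf c -> U c z ->
  exists2 e, e \in children c & U e z.
Hypothesis children_sub : forall c e, wf c -> e \in children c -> U e `<=` U c.
(** Disjointness of the children in integrated form; this form passes by induction to descendants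
    and to stopped cells. *)
Hypothesis children_sum : forall c E, wf c -> measurable E ->
  (\sum_(e <- children c) mu (E `&` U e) <= mu (E `&` U c))%E.

Fixpoint desc k c : seq C :=
  if k is k'.+1 then flatten [seq desc k' e | e <- children c] else [:: c].

(** The stopping cells down to depth [k]. The root is not tested, and a branch ends at its first bad
    cell. *)
Fixpoint max_bad (bad : pred C) k c : seq C :=
  if k is k'.+1 then
    flatten [seq (if bad e then [:: e] else max_bad bad k' e) | e <- children c]
  else [::].

Lemma desc_wf k c e : wf c -> e \in desc k c -> wf e.
Proof.
elim: k c => [|k IH] c wc /=; first by rewrite inE => /eqP ->.
by move=> /flatten_mapP[c' c'c]; apply: IH; exact: wf_children c'c.
Qed.

Lemma desc_children k c e e' : e \in desc k c -> e' \in children e -> e' \in desc k.+1 c.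
Proof.
elim: k c => [|k IH] c.
  rewrite inE => /eqP -> ec /=; apply/flatten_mapP; exists e' => //.
  by rewrite inE.
move=> /flatten_mapP[c' c'c ec'] e'e; apply/flatten_mapP; exists c' => //.
exact: IH.
Qed.

Lemma desc_cover k c z : wf c -> U c z -> exists2 e, e \in desc k c & U e z.
Proof.
elim: k c => [|k IH] c wc Uz; first by exists c; rewrite ?inE.
have [c' c'c Uc'] := children_cover wc Uz.
have [e ec' Ue] := IH c' (wf_children wc c'c) Uc'.
by exists e => //; apply/flatten_mapP; exists c'.
Qed.

Lemma desc_sum k c E : wf c -> measurable E ->
  (\sum_(e <- desc k c) mu (E `&` U e) <= mu (E `&` U c))%E.
Proof.
move=> + mE; elim: k c => [|k IH] c wc; first by rewrite big_seq1.
rewrite big_flatten big_map; apply: le_trans (children_sum wc mE).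
rewrite big_seq [leRHS]big_seq; apply: lee_sum => e ec.
by apply: IH; exact: wf_children ec.
Qed.

Lemma max_bad_sum bad k c E : wf c -> measurable E ->
  (\sum_(e <- max_bad bad k c) mu (E `&` U e) <= mu (E `&` U c))%E.
Proof.
move=> + mE; elim: k c => [|k IH] c wc; first by rewrite big_nil.
rewrite big_flatten big_map; apply: le_trans (children_sum wc mE).
rewrite big_seq [leRHS]big_seq; apply: lee_sum => e ec.
by case: ifPn => _; [rewrite big_seq1|apply: IH; exact: wf_children ec].
Qed.

Lemma desc_sub k c e : wf c -> e \in desc k c -> U e `<=` U c.
Proof.
elim: k c => [|k IH] c wc /=; first by rewrite inE => /eqP ->.
move=> /flatten_mapP[c' c'c ec']; apply: subset_trans (children_sub wc c'c).
exact: IH (wf_children wc c'c) ec'.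
Qed.

(** Along the path from the root to [b], either some cell is bad, and the first such one was stopped
    and contains [b], or [b] itself is good. *)
Lemma max_bad_or_good (bad : pred C) k c b z : wf c -> ~~ bad c ->
  b \in desc k c -> U b z -> (exists2 e, e \in max_bad bad k c & U e z) \/ ~~ bad b.
Proof.
elim: k c => [|k IH] c wc gc; first by rewrite inE => /eqP -> _; right.
move=> /flatten_mapP[c' c'c bc'] Uz; have wc' := wf_children wc c'c.
have [bc|gc'] := boolP (bad c').
  left; exists c'; last exact: desc_sub bc' _ Uz.
  by apply/flatten_mapP; exists c'; rewrite ?bc ?inE.
have [[e ec' Ue]|] := IH c' wc' gc' bc' Uz; last by right.
by left; exists e => //; apply/flatten_mapP; exists c' => //; rewrite (negbTE gc').
Qed.

Lemma max_badS (bad : pred C) k c : {subset max_bad bad k c <= max_bad bad k.+1 c}.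
Proof.
elim: k c => [//|k IH] c b /flatten_mapP[e ec].
by case: ifPn => be bin; apply/flatten_mapP; exists e => //; rewrite ?be // (negbTE be); exact: IH.
Qed.

(** The search descends only through good cells, so the parent of a stopped cell is good; [P] is any
    property inherited by children. *)
Lemma max_bad_parent (bad : pred C) (P : C -> Prop) k c b :
  (forall e e', P e -> e' \in children e -> P e') -> P c -> ~~ bad c ->
  b \in max_bad bad k c ->
  bad b /\ exists e, [/\ P e, ~~ bad e & b \in children e].
Proof.
move=> hP; elim: k c => [//|k IH] c Pc gc /flatten_mapP[e ec].
case: ifPn => be; last by apply: IH => //; exact: hP ec.
by rewrite inE => /eqP ->; split => //; exists c.
Qed.

(* A density-point argument: open sets O close to E are, up to deep cells,
   unions of cells in which E has proportion at most 1/2. *)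
Lemma density_null c (E : set T) : wf c -> (mu (U c) < +oo)%E ->
  measurable E -> E `<=` U c ->
  (forall e : R, 0 < e -> exists O, [/\ measurable O,
     (mu (O `&` U c) <= mu E + e%:E)%E &
     forall z, E z -> exists k, forall b, b \in desc k c -> U b z -> U b `<=` O]) ->
  (forall k b, b \in desc k c -> E `&` U b !=set0 ->
     (mu (E `&` U b) <= 2^-1%:E * mu (U b))%E) ->
  mu E = 0.
Proof.
move=> wc Uc_fin mE EU reg half.
have E_fin : mu E \is a fin_num.
  by rewrite ge0_fin_numE //; apply: le_lt_trans Uc_fin; apply: le_measure; rewrite ?inE.
suff small (e : R) : 0 < e -> (mu E <= e%:E)%E.
  by apply/eqP; rewrite eq_le measure_ge0 andbT; apply/lee_addgt0Pr => e e0; rewrite add0e small.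
move=> e0; have [ O [mO leO inO]] := reg e e0.
pose F k := E `&` \big[setU/set0]_(b <- desc k c | `[< U b `<=` O >]) U b.
have mF k : measurable (F k).
  by apply: measurableI => //; apply: bigsetU_measurable.
have FE k z : F k z <-> E z /\ exists b, [/\ b \in desc k c, U b `<=` O & U b z].
  split=> [[Ez]|[Ez [b [bk bO Ub]]]].
    rewrite -bigcup_seq_cond => -[b /= /andP[bk /asboolP bO] Ub].
    by split => //; exists b.
  split => //; rewrite -bigcup_seq_cond; exists b => //=.
  by rewrite bk; apply/asboolP.
have iF k : F k `<=` F k.+1.
  move=> z /FE[Ez [b [bk bO Ub]]]; apply/FE; split => //.
  have wb := desc_wf wc bk.
  have [b' b'b Ub'] := children_cover wb Ub.
  exists b'; split => //; first exact: desc_children b'b.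
  exact: subset_trans (children_sub wb b'b) bO.
have EF : E = \bigcup_k F k.
  apply/seteqP; split => [z Ez|z [k _ []] //].
  have [k kO] := inO z Ez; exists k => //; apply/FE; split => //.
  have [b bk Ub] := desc_cover k wc (EU z Ez).
  by exists b; split => //; exact: kO.
have leF k : (mu (F k) <= 2^-1%:E * (mu E + e%:E))%E.
  apply: le_trans (_ : 2^-1%:E * mu (O `&` U c) <= _)%E; last first.
    by rewrite lee_pmul2l // lte_fin invr_gt0.
  rewrite /F; under eq_bigr do rewrite -(setIid (U _)).
  apply: (@le_trans _ _ (\sum_(b <- desc k c | `[< U b `<=` O >]) mu (E `&` U b))%E).
    rewrite (_ : E `&` _ = \big[setU/set0]_(b <- desc k c | `[< U b `<=` O >]) (E `&` U b)).
      by apply: measure_bigsetU_le => b _; exact: measurableI.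
    by rewrite -!bigcup_seq_cond setI_bigcupr; apply: eq_bigcupr => b _; rewrite setIid.
  apply: (@le_trans _ _ (\sum_(b <- desc k c) 2^-1%:E * mu (O `&` U b))%E); last first.
    rewrite -ge0_sume_distrr; last by move=> *; exact: measure_ge0.
    by rewrite lee_pmul2l // ?lte_fin ?invr_gt0 //; exact: desc_sum.
  rewrite big_mkcond [leLHS]big_seq [leRHS]big_seq; apply: lee_sum => b bk.
  case: asboolP => [bO|_]; last by rewrite mule_ge0.
  rewrite (setIidr bO); have [ne|/set0P/negP/negPn/eqP ->] := pselect (E `&` U b !=set0).
    exact: half bk ne.
  by rewrite measure0 mule_ge0.
(* From [m <= (m + e) / 2] with [m] finite it follows that [m <= e]. *)
have : (mu E <= 2^-1%:E * (mu E + e%:E))%E.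
  by rewrite {1}EF; exact: measure_bigcup_le.
by move: E_fin; case: (mu E) => // m _; rewrite -EFinD -EFinM !lee_fin; lra.
Qed.

End subdivision_tree.

(** * Parabolic cells *)

Section powR_extra.
Context {R : realType}.

Lemma powR_div (x y p : R) : 0 <= x -> 0 < y -> (x / y) `^ p = x `^ p / y `^ p.
Proof.
move=> x0 y0; rewrite powRM ?invr_ge0 ?(ltW y0) //; congr (_ * _).
apply: (mulIf (lt0r_neq0 (powR_gt0 p y0))).
by rewrite -powRM ?invr_ge0 ?(ltW y0) // !mulVf ?lt0r_neq0 ?powR_gt0 // powR1.
Qed.

Lemma interval_subdivision (a w z : R) (N : nat) : (0 < N)%N -> 0 < w ->
  a <= z < a + w ->
  exists i : 'I_N, a + i%:R * (w / N%:R) <= z < a + i.+1%:R * (w / N%:R).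
Proof.
move=> N0 w0 zaw; have Nr : 0 < N%:R :> R by rewrite ltr0n.
have h0 : 0 < w / N%:R by rewrite divr_gt0.
pose y := (z - a) / (w / N%:R).
have zE : z = a + y * (w / N%:R) by rewrite /y divfK ?lt0r_neq0 //; lra.
have y0 : 0 <= y by rewrite /y divr_ge0 ?(ltW h0) //; lra.
have yN : y < N%:R by rewrite /y ltr_pdivrMr // mulrC divfK ?lt0r_neq0 //; lra.
have iN : (Num.truncn y < N)%N by rewrite truncn_lt_nat.
have /andP[iy yi] := truncn_itv y0.
by exists (Ordinal iN); rewrite {1 2}zE lerD2l ltrD2l ler_pM2r // ltr_pM2r // iy yi.
Qed.

Lemma interval_subdivision_unique (a h z : R) (i j : nat) : 0 < h ->
  a + i%:R * h <= z < a + i.+1%:R * h ->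
  a + j%:R * h <= z < a + j.+1%:R * h -> i = j.
Proof.
move=> h0 /andP[zi1 zi2] /andP[zj1 zj2]; apply/eqP; rewrite eqn_leq.
rewrite -ltnS -(ltr_nat R) -[_ && _]andbC -[(j <= i)%N]ltnS -(ltr_nat R).
by rewrite -(ltr_pM2r h0) -[X in _ && X](ltr_pM2r h0); lra.
Qed.

End powR_extra.

Section parabolic_cells.
Context {R : realType} {n : nat} (p beta : R) (N : nat).
Local Notation ST := ('rV[R]_n * R)%type.
Local Notation mu := (@lebesgue_spacetime R n).
Local Notation P := (N%:R `^ p).

(* A cell is coded by its spatial centre, half-side, initial time, duration. *)
Definition pcell : choiceType := ('rV[R]_n * R * R * R)%type.
Definition cc (c : pcell) : 'rV[R]_n := c.1.1.1.
Definition cl (c : pcell) : R := c.1.1.2.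
Definition cb (c : pcell) : R := c.1.2.
Definition ct (c : pcell) : R := c.2.

Definition cset s c : set ST := cell s (cc c) (cl c) (cb c) (cb c + ct c).

(** As [N^p] need not be an integer, the durations cannot follow the scaling [beta * l^p] exactly.
    With [y] the quotient, the number of slices lies in []y, y + 1]], so for [1 <= y] the slices
    have between half of the ideal duration and all of it. This is the slack allowed in
    [cell_wf]. *)
Definition nsub c : nat := (Num.truncn (ct c / (beta * (cl c / N%:R) `^ p))).+1.

Definition subcell c (ij : {ffun 'I_n -> 'I_N} * 'I_(nsub c)) : pcell :=
  (\row_a (cc c ord0 a - cl c + (ij.1 a).*2.+1%:R * (cl c / N%:R)),
   cl c / N%:R, cb c + ij.2%:R * (ct c / (nsub c)%:R), ct c / (nsub c)%:R).

Arguments subcell : clear implicits.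

Definition subcells c : seq pcell :=
  [seq subcell c ij | ij <- enum {: {ffun 'I_n -> 'I_N} * 'I_(nsub c)}].

Definition cell_pos c := 0 < cl c /\ 0 < ct c.

Definition cell_wf c :=
  0 < cl c /\ beta * cl c `^ p / 2 <= ct c <= beta * cl c `^ p.

Hypothesis N_gt0 : (0 < N)%N.

Let Nr : 0 < N%:R :> R. Proof. by rewrite ltr0n. Qed.
Let nsub_gt0 c : 0 < (nsub c)%:R :> R. Proof. by rewrite ltr0n. Qed.

Lemma subcells_pos c e : cell_pos c -> e \in subcells c -> cell_pos e.
Proof. by move=> [l0 t0] /mapP[ij _ ->]; split; rewrite divr_gt0. Qed.

Let subcell_itv c (ij : {ffun _ -> _} * _) a : [/\
  cc (subcell c ij) ord0 a - cl (subcell c ij) =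
    cc c ord0 a - cl c + (ij.1 a)%:R * (2 * cl c / N%:R) &
  cc (subcell c ij) ord0 a + cl (subcell c ij) =
    cc c ord0 a - cl c + (ij.1 a).+1%:R * (2 * cl c / N%:R) ].
Proof.
rewrite /subcell /cc /cl /= !mxE -!natr1 -addnn natrD.
by split; ring.
Qed.

Let subcell_time c (ij : {ffun _ -> _} * _) :
  cb (subcell c ij) + ct (subcell c ij) = cb c + ij.2.+1%:R * (ct c / (nsub c)%:R).
Proof. by rewrite /subcell /cb /ct /= -natr1; ring. Qed.

Lemma subcells_cover s c z : cell_pos c -> cset s c z ->
  exists2 e, e \in subcells c & cset s e z.
Proof.
move=> [l0 t0] [zx zt].
have /fin_all_exists[f fP] : forall a, exists i : 'I_N,
    cc c ord0 a - cl c + i%:R * (2 * cl c / N%:R) <= z.1 ord0 a <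
    cc c ord0 a - cl c + i.+1%:R * (2 * cl c / N%:R).
  move=> a; apply: interval_subdivision => //; first by rewrite mulr_gt0.
  by have := zx a; rewrite -/(cc c); lra.
have [j jP] := interval_subdivision (ltn0Sn _ : 0 < nsub c)%N t0 zt.
pose ij : {ffun 'I_n -> 'I_N} * 'I_(nsub c) := (finfun f, j).
exists (subcell c ij); first by apply: map_f; rewrite mem_enum.
split => [a|]; last by rewrite subcell_time.
by have [-> ->] := subcell_itv ij a; rewrite ffunE.
Qed.

Lemma subcells_bounds c e : cell_pos c -> e \in subcells c -> [/\
  forall a, cc c ord0 a - cl c <= cc e ord0 a - cl e,
  forall a, cc e ord0 a + cl e <= cc c ord0 a + cl c,
  cb c <= cb e & cb e + ct e <= cb c + ct c].
Proof.
move=> [l0 t0] /mapP[ij _ ->]; split.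
- move=> a; have [-> _] := subcell_itv ij a.
  by rewrite lerDl mulr_ge0 // divr_ge0 ?ltW // mulr_gt0.
- move=> a; have [_ ->] := subcell_itv ij a.
  suff : (ij.1 a).+1%:R * (2 * cl c / N%:R) <= 2 * cl c by lra.
  by rewrite mulrA ler_pdivrMr // mulrC ler_pM2l ?mulr_gt0 // ler_nat.
- by rewrite lerDl mulr_ge0 // divr_ge0 // ltW.
- rewrite subcell_time lerD2l mulrA ler_pdivrMr // mulrC ler_pM2l //.
  by rewrite ler_nat.
Qed.

Lemma subcells_sub s c e : cell_pos c -> e \in subcells c -> cset s e `<=` cset s c.
Proof.
move=> pc ec; have [H1 H2 H3 H4] := subcells_bounds pc ec.
move=> z [zx zt]; split => [a|]; last lra.
by have := zx a; have := H1 a; have := H2 a; lra.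
Qed.

Lemma measurable_cset s c : measurable (cset s c : set (spacetime R n)).
Proof. exact: measurable_cell. Qed.

Lemma subcells_sum s c (E : set (spacetime R n)) : cell_pos c -> measurable E ->
  (\sum_(e <- subcells c) mu (E `&` cset s e) <= mu (E `&` cset s c))%E.
Proof.
move=> pc mE; have [l0 t0] := pc; rewrite big_map.
apply: sum_measure_disjoint_le.
- by apply: measurableI => //; exact: measurable_cset.
- by move=> ij; apply: measurableI => //; exact: measurable_cset.
- move=> ij ijP; apply: setIS; apply: subcells_sub => //.
  exact: map_f.
- exact: enum_uniq.
move=> ij ij' _ _ [z [[_ [zx zt]] [_ [zx' zt']]]].
have w0 : 0 < 2 * cl c / N%:R by rewrite divr_gt0 // mulr_gt0.
have h0 : 0 < ct c / (nsub c)%:R by rewrite divr_gt0.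
case: ij ij' zx zt zx' zt' => [f j] [f' j'] zx zt zx' zt'; congr (_, _).
  apply/ffunP => a; apply/val_inj => /=.
  apply: (@interval_subdivision_unique _ (cc c ord0 a - cl c) _ (z.1 ord0 a) _ _ w0).
    by have := zx a; have [-> ->] := subcell_itv (f, j) a.
  by have := zx' a; have [-> ->] := subcell_itv (f', j') a.
apply/val_inj => /=; apply: (@interval_subdivision_unique _ (cb c) _ (otime s z.2) _ _ h0).
  by rewrite -(subcell_time (f, j)); exact: zt.
by rewrite -(subcell_time (f', j')); exact: zt'.
Qed.

Lemma mu_cset s c : cell_pos c -> mu (cset s c) = ((2 * cl c) ^+ n * ct c)%:E.
Proof.
move=> [l0 t0]; rewrite /cset lebesgue_cell ?ltW //; last by rewrite ltrDl.
by congr (_ * _)%:E; lra.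
Qed.

Hypothesis beta_gt0 : 0 < beta.

Lemma cell_wf_pos c : cell_wf c -> cell_pos c.
Proof.
move=> [l0 /andP[H _]]; split => //; apply: lt_le_trans H.
by rewrite divr_gt0 // mulr_gt0 // powR_gt0.
Qed.

(** No upper bound is put on the duration of [c], so the lemma applies also to a whole upper part,
    which is too tall to be well formed. There are at least two time slices, hence the halving of
    the duration. *)
Lemma subcells_wf c e : 0 < cl c -> beta * (cl c / N%:R) `^ p <= ct c ->
  e \in subcells c -> cell_wf e /\ 2 * ct e <= ct c.
Proof.
move=> l0 tc /mapP[ij _ ->].
have hl : 0 < beta * (cl c / N%:R) `^ p by rewrite mulr_gt0 // powR_gt0 // divr_gt0.
have y1 : 1 <= ct c / (beta * (cl c / N%:R) `^ p) by rewrite ler_pdivlMr // mul1r.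
have t0 : 0 < ct c by exact: lt_le_trans tc.
have M2 : 2 <= (nsub c)%:R :> R.
  by rewrite (ler_nat _ 2) /nsub ltnS truncn_gt0.
have /andP[My yM] := truncn_itv (le_trans ler01 y1).
have {}My : (nsub c)%:R <= ct c / (beta * (cl c / N%:R) `^ p) + 1.
  by rewrite /nsub -natr1 lerD2r.
have {}yM : ct c / (beta * (cl c / N%:R) `^ p) < (nsub c)%:R by [].
have cE : ct c = ct c / (beta * (cl c / N%:R) `^ p) * (beta * (cl c / N%:R) `^ p).
  by rewrite divfK // lt0r_neq0.
rewrite /cell_wf.
have -> : ct (subcell c ij) = ct c / (nsub c)%:R by [].
have -> : cl (subcell c ij) = cl c / N%:R by [].
move: hl y1 My yM cE; set b := beta * _; set y := _ / b; move: M2 (nsub_gt0 c).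
set M := (nsub c)%:R => M2 M0 b0 y1 My yM cE.
split; last by rewrite mulrA ler_pdivrMr // [_ * ct c]mulrC ler_pM2l.
split; first by rewrite divr_gt0.
by rewrite ler_pdivlMr // ler_pdivrMr // cE; apply/andP; split; nra.
Qed.

End parabolic_cells.

(** * Vitali packing *)

(** Take an element of largest size, discard all that meet it, and repeat; whatever is discarded
    meets a selected element at least as large. *)
Lemma greedy_selection (I : eqType) (d : Order.disp_t) (S : orderType d)
    (size : I -> S) (meet : rel I) (s : seq I) :
  reflexive meet -> symmetric meet ->
  exists sel : seq I, [/\ {subset sel <= s}, uniq sel,
    {in sel &, forall i j, meet i j -> i = j} &
    forall i, i \in s -> exists2 j, j \in sel & meet i j && (size i <= size j)%O].
Proof.
move=> meet_refl meet_sym; move: {2}(seq.size s) (leqnn (seq.size s)) => k.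
elim: k s => [|k IH] s sk.
  by exists [::]; split => // i; move: sk; rewrite leqn0 size_eq0 => /eqP ->.
have [->|[m ms mmax]] : s = [::] \/ exists2 m, m \in s & forall i, i \in s -> (size i <= size m)%O.
- elim: s {sk} => [|x s IHs]; [by left|right].
  have [->|[m ms mmax]] := IHs.
    by exists x; rewrite ?inE // => i; rewrite inE => /eqP ->.
  have [xm|mx] := leP (size x) (size m).
    exists m; first by rewrite inE ms orbT.
    by move=> i; rewrite inE => /predU1P[->//|/mmax].
  exists x; first by rewrite inE eqxx.
  by move=> i; rewrite inE => /predU1P[->//|/mmax im]; apply: le_trans (ltW mx).
- by exists [::].
pose s' := [seq i <- s | ~~ meet i m].
have s'k : (seq.size s' <= k)%N.
  rewrite -ltnS; apply: leq_trans sk; rewrite size_filter ltn_neqAle count_size andbT -all_count.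
  by apply/negP => /allP /(_ m ms); rewrite meet_refl.
have [sel [sel_sub sel_uniq sel_disj sel_cov]] := IH s' s'k.
have sel_m i : i \in sel -> ~~ meet i m.
  by move=> /sel_sub; rewrite mem_filter => /andP[].
exists (m :: sel); split.
- move=> i; rewrite inE => /predU1P[->//|/sel_sub].
  by rewrite mem_filter => /andP[].
- rewrite /= sel_uniq andbT; apply/negP => /sel_m.
  by rewrite meet_refl.
- move=> i j; rewrite !inE => /predU1P[->|is'] /predU1P[->|js'] //.
  + by move=> mj; have := sel_m _ js'; rewrite meet_sym mj.
  + by move=> im; have := sel_m _ is'; rewrite im.
  + exact: sel_disj.
- move=> i is_; have [im|im] := boolP (meet i m).
    by exists m; rewrite ?inE ?eqxx // im mmax.
  have [|j js' ij] := sel_cov i; first by rewrite mem_filter im.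
  by exists j => //; rewrite inE js' orbT.
Qed.

Section parabolic_rectangles.
Context {R : realType} {n : nat} (p gamma : R) (N : nat).
Local Notation ST := ('rV[R]_n * R)%type.
Local Notation mu := (@lebesgue_spacetime R n).
Local Notation P := (N%:R `^ p).
Local Notation beta := ((1 - gamma) / 2).

Definition full s x l t : set ST := slab s x l (t - l `^ p) (t + l `^ p).
Definition upper s x l t : set ST := slab s x l (t + gamma * l `^ p) (t + l `^ p).
Definition lower s x l t : set ST := slab s x l (t - l `^ p) (t - gamma * l `^ p).

Hypothesis p_gt0 : 0 < p.
Hypothesis gamma_gt0 : 0 < gamma.
Hypothesis gamma_lt1 : gamma < 1.

Lemma slab_sub s (x x' : 'rV[R]_n) l l' a b a' b' :
  (forall i, x' ord0 i - l' <= x ord0 i - l /\ x ord0 i + l <= x' ord0 i + l') ->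
  a' <= a -> b <= b' -> slab s x l a b `<=` slab s x' l' a' b'.
Proof.
move=> H aa bb z [zx zt]; split=> [i|]; last lra.
by have := zx i; have := H i; rewrite !ler_norml; lra.
Qed.

Lemma upper_full s x l t : 0 <= l -> upper s x l t `<=` full s x l t.
Proof. by move=> l0; have lp := powR_ge0 l p; have glp := mulr_ge0 (ltW gamma_gt0) lp;
  have glp' := ler_wpM2r lp (ltW gamma_lt1); apply: slab_sub => [i||]; [by []|lra|lra]. Qed.

Lemma lower_full s x l t : 0 <= l -> lower s x l t `<=` full s x l t.
Proof. by move=> l0; have lp := powR_ge0 l p; have glp := mulr_ge0 (ltW gamma_gt0) lp;
  have glp' := ler_wpM2r lp (ltW gamma_lt1); apply: slab_sub => [i||]; [by []|lra|lra]. Qed.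

Lemma mu_upper s x l t : 0 < l ->
  mu (upper s x l t) = ((2 * l) ^+ n * ((1 - gamma) * l `^ p))%:E.
Proof.
move=> l0; have lp := powR_ge0 l p; have glp := ler_wpM2r lp (ltW gamma_lt1).
rewrite /upper lebesgue_slab ?(ltW l0) //; last lra.
by congr (_ * _)%:E; ring.
Qed.

Lemma mu_lower s x l t : 0 < l ->
  mu (lower s x l t) = ((2 * l) ^+ n * ((1 - gamma) * l `^ p))%:E.
Proof.
move=> l0; have lp := powR_ge0 l p; have glp := ler_wpM2r lp (ltW gamma_lt1).
rewrite /lower lebesgue_slab ?(ltW l0) //; last lra.
by congr (_ * _)%:E; ring.
Qed.

(* The centre time of the rectangle with the cell at the top of its upper part. *)
Definition ctop (c : @pcell R n) := cb c + ct c - cl c `^ p.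
Definition cfull s c := full s (cc c) (cl c) (ctop c).
Definition cupper s c := upper s (cc c) (cl c) (ctop c).
Definition clower s c := lower s (cc c) (cl c) (ctop c).

Local Notation wf := (cell_wf p beta).

Lemma cset_upper s c : wf c -> cset s c `<=` cupper s c.
Proof.
move=> [l0 wt] z [zx zt]; have lp := powR_gt0 p l0.
have glp : gamma * cl c `^ p < cl c `^ p by rewrite gtr_pMl.
split=> [i|].
  by have := zx i; rewrite ler_norml; lra.
by rewrite /ctop; lra.
Qed.

(** The cell has duration at least [beta * l^p / 2], a quarter of the height [(1 - gamma) * l^p] of
    the upper part. *)
Lemma mu_upper_cset s c : wf c -> (mu (cupper s c) <= 4%:E * mu (cset s c))%E.
Proof.
move=> [l0 wt]; have lp := powR_gt0 p l0.
have glp : 0 < (1 - gamma) * cl c `^ p by rewrite mulr_gt0 // subr_gt0.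
rewrite mu_upper // mu_cset; last by split => //; lra.
by rewrite -EFinM lee_fin [leRHS]mulrCA ler_pM2l ?exprn_gt0 ?mulr_gt0 //; lra.
Qed.

Hypothesis N_gt0 : (0 < N)%N.
(** The cell occupies at most the top half of its upper part, which leaves at least [beta * l^p]
    below it. The rectangle of a child has height [2 * (l / N)^p], less than that, and so lies in
    the upper part of its parent. *)
Hypothesis P_large : 2 < beta * P.

Let Nr : 0 < N%:R :> R. Proof. by rewrite ltr0n. Qed.
Let beta_gt0 : 0 < beta. Proof. by have g1 := gamma_lt1; lra. Qed.
Let P_gt0 : 0 < P. Proof. exact: powR_gt0. Qed.
Let P_gt4 : 4 < P.
Proof.
have g0 := gamma_gt0; have g1 := gamma_lt1; have Pl := P_large.
have b2 : beta < 2^-1 by lra.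
have : beta * P < 2^-1 * P by rewrite ltr_pM2r.
by lra.
Qed.

Lemma cell_wf_subcells (c e : @pcell R n) : wf c -> e \in subcells p beta N c -> wf e /\ 2 * ct e <= ct c.
Proof.
move=> [l0 wt] ec; have lp := powR_gt0 p l0; have b0 := beta_gt0.
apply: (subcells_wf N_gt0 beta_gt0 l0) ec.
have blp : 0 < beta * cl c `^ p by rewrite mulr_gt0.
have t0 : 0 < ct c by lra.
have P4 := P_gt4; have P2 : 2 <= P by lra.
have H : 2 * ct c <= P * ct c by rewrite ler_pM2r.
by rewrite powR_div ?(ltW l0) // mulrA ler_pdivrMr //; lra.
Qed.

Lemma subcells_cl (c e : @pcell R n) : e \in subcells p beta N c -> cl e = cl c / N%:R.
Proof. by move=> /mapP[ij _ ->]. Qed.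

Lemma subcells_full s (c e : @pcell R n) : wf c -> e \in subcells p beta N c ->
  cfull s e `<=` cupper s c.
Proof.
move=> wc ec; have pc := cell_wf_pos beta_gt0 wc; have [l0 wt] := wc.
have [H1 H2 H3 H4] := subcells_bounds N_gt0 pc ec.
have [[el0 et] _] := cell_wf_subcells wc ec.
have lp := powR_gt0 p l0.
apply: slab_sub => [i| |]; first by have := H1 i; have := H2 i; lra.
  have : cl e `^ p = cl c `^ p / P by rewrite (subcells_cl ec) powR_div ?ltW.
  move=> clE; have : 2 * cl e `^ p < beta * cl c `^ p.
    by rewrite clE mulrA ltr_pdivrMr // mulrAC ltr_pM2r.
  have P4 := P_gt4; have := powR_gt0 p el0; move: et; rewrite /ctop.
  by lra.
by rewrite /ctop; lra.
Qed.

(** Bound on the number of children: [N^n] in space, at most [P + 1] in time. *)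
Definition subcell_ratio := N%:R ^+ n * (P + 1).

Lemma mu_subcells s (c e : @pcell R n) : wf c -> e \in subcells p beta N c ->
  (mu (cset s c) <= subcell_ratio%:E * mu (cset s e))%E.
Proof.
move=> wc ec; have pc := cell_wf_pos beta_gt0 wc.
have pe := subcells_pos N_gt0 pc ec; have [l0 t0] := pc.
rewrite !mu_cset // -EFinM lee_fin (subcells_cl ec).
have [_ wt] := wc; have lp := powR_gt0 p l0.
have -> : ct e = ct c / (nsub p beta N c)%:R by move: ec => /mapP[ij _ ->].
have M0 : 0 < (nsub p beta N c)%:R :> R by rewrite ltr0n.
have Nn : N%:R ^+ n != 0 :> R by rewrite expf_neq0 ?lt0r_neq0.
rewrite [leRHS](_ : _ = (2 * cl c) ^+ n * ((P + 1) * ct c / (nsub p beta N c)%:R)); last first.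
  rewrite [2 * (cl c / _)]mulrA expr_div_n /subcell_ratio; field.
  by rewrite Nn lt0r_neq0.
rewrite ler_pM2l ?exprn_gt0 ?mulr_gt0 // ler_pdivlMr // mulrC ler_pM2r //.
have y0 : 0 <= ct c / (beta * (cl c / N%:R) `^ p).
  by rewrite divr_ge0 ?(ltW t0) // mulr_ge0 ?powR_ge0 // ltW.
rewrite /nsub -natr1 lerD2r; apply: le_trans (andP (truncn_itv y0)).1 _.
rewrite powR_div ?(ltW l0) // ler_pdivrMr ?mulr_gt0 ?invr_gt0 ?subr_gt0 //.
rewrite [leRHS](_ : _ = beta * cl c `^ p); first by case/andP: wt.
by field; rewrite lt0r_neq0.
Qed.

(** Each generation divides the side by [N >= 2] and at least halves the duration. *)
Lemma desc_small (c : @pcell R n) (e : R) : wf c -> 0 < e ->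
  exists k, forall b, b \in desc (subcells p beta N) k c -> 2 * cl b < e /\ ct b < e.
Proof.
move=> wc e0.
have N2 : (2 : R) <= N%:R.
  rewrite (ler_nat _ 2) ltnNge; apply/negP => N1.
  have NE : N = 1%N by apply/eqP; rewrite eqn_leq N1.
  by have := P_gt4; rewrite NE powR1; lra.
have small k b : b \in desc (subcells p beta N) k c -> cl b * 2 ^+ k <= cl c /\ ct b * 2 ^+ k <= ct c.
  elim: k c wc b => [|k IH] c' wc' b; first by rewrite inE => /eqP ->; rewrite !mulr1.
  move=> /flatten_mapP[c'' c''c bc'']; have [wc'' tt] := cell_wf_subcells wc' c''c.
  have [lb tb] := IH c'' wc'' b bc''.
  have ll : cl c'' * 2 <= cl c'.
    rewrite (subcells_cl c''c) mulrAC ler_pdivrMr // ler_pM2l //; by case: wc'.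
  by rewrite !exprS; split; lra.
pose m := Num.truncn (Num.max (2 * cl c) (ct c) / e).
exists m.+1 => b bm; have [lb tb] := small _ _ bm.
have [l0 t0] := cell_wf_pos beta_gt0 wc.
have k2 : Num.max (2 * cl c) (ct c) < e * 2 ^+ m.+1.
  rewrite [e * _]mulrC -ltr_pdivrMr //.
  have m2 : m.+1%:R < 2%:R ^+ m.+1 :> R by rewrite -natrX ltr_nat ltn_expl.
  exact: lt_trans (truncnS_gt _) m2.
move: k2; rewrite gt_max => /andP[k2 k2'].
have q0 : 0 < 2 ^+ m.+1 :> R by rewrite exprn_gt0.
by split; rewrite -(ltr_pM2r q0); lra.
Qed.

(** Measure of [star v] over that of the lower part: three times the side, height [4 * l^p] against
    [(1 - gamma) * l^p]. *)
Definition packing_ratio : R := 3 ^+ n * (4 / (1 - gamma)).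

(* Vitali selection on the lower parts: they are disjoint for the selected
   cells, while dilated cylinders around these contain all the cells. *)
Lemma packing s (bs : seq pcell) (G : set (spacetime R n)) :
  (forall b, b \in bs -> wf b) -> measurable G ->
  (forall E : set (spacetime R n), measurable E ->
     (\sum_(b <- bs) mu (E `&` cset s b) <= mu E)%E) ->
  (forall b, b \in bs -> (mu (clower s b) <= 2%:E * mu (G `&` clower s b))%E) ->
  (\sum_(b <- bs) mu (cset s b) <= (packing_ratio * 2)%:E * mu G)%E.
Proof.
move=> wbs mG sumE lowG.
pose meet b b' := `[< clower s b `&` clower s b' !=set0 >] || (b == b').
have meet_refl : reflexive meet by move=> b; rewrite /meet eqxx orbT.
have meet_sym : symmetric meet.
  by move=> b b'; rewrite /meet setIC eq_sym.
have [sel [sel_sub sel_uniq sel_disj sel_cov]] := greedy_selection (@cl R n) bs meet_refl meet_sym.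
(* If the lower part of [b] meets that of a larger [v], then [ctop b] is below [ctop v + l_v^p], and
   the cell of [b] ends at most [l_v^p] later. *)
pose star (b : @pcell R n) : set ST := slab s (cc b) (3 * cl b) (ctop b - 2 * cl b `^ p) (ctop b + 2 * cl b `^ p).
have in_star b : b \in bs -> exists2 v, v \in sel & cset s b `<=` star v.
  move=> bb; have [v vsel /andP[bv lbv]] := sel_cov b bb; exists v => //.
  have [lb0 wb] := wbs b bb; have [lv0 wv] := wbs v (sel_sub v vsel).
  have pb := powR_gt0 p lb0; have pv := powR_gt0 p lv0.
  have g0 := gamma_gt0; have g1 := gamma_lt1.
  have pbv : cl b `^ p <= cl v `^ p.
    by apply: ge0_ler_powR; rewrite ?nnegrE ?(ltW p_gt0) ?(ltW lb0) ?(ltW lv0).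
  move: bv => /orP[/asboolP[w [[wb1 wb2] [wv1 wv2]]]|/eqP <-]; last first.
    move=> z [zx zt]; split=> [i|]; last by rewrite /ctop; nra.
    by have := zx i; rewrite ler_norml; lra.
  move=> z [zx zt]; split=> [i|]; last first.
    by move: wb2 wv2; rewrite /ctop; nra.
  have := zx i; have := wb1 i; have := wv1 i; rewrite !ler_norml; lra.
have mstar b : measurable (star b : set (spacetime R n)) by exact: measurable_slab.
have mu_star v : v \in sel -> mu (star v) = (packing_ratio%:E * mu (clower s v))%E.
  move=> vsel; have [l0 _] := wbs v (sel_sub v vsel); have lp := powR_gt0 p l0.
  have g1 := gamma_lt1; rewrite lebesgue_slab; [|by rewrite ltW // mulr_gt0|lra].
  rewrite mu_lower // -EFinM /packing_ratio mulrCA exprMn.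
  by congr (_)%:E; field; lra.
(* Each cell is charged to a dilated cylinder containing it. After exchanging the sums, [sumE] with
   [E] the cylinder bounds the total charge. *)
have step1 : (\sum_(b <- bs) mu (cset s b) <= \sum_(v <- sel) mu (star v))%E.
  apply: (@le_trans _ _ (\sum_(b <- bs) \sum_(v <- sel) mu (star v `&` cset s b))%E).
    rewrite big_seq [leRHS]big_seq; apply: lee_sum => b bb.
    have [v vsel bv] := in_star b bb.
    by rewrite (bigD1_seq v) //= (setIidr bv) leeDl // sume_ge0.
  by rewrite exchange_big; apply: lee_sum => v _; exact: sumE.
apply: le_trans step1 _.
apply: (@le_trans _ _ (\sum_(v <- sel) (packing_ratio * 2)%:E * mu (G `&` clower s v))%E).
  rewrite big_seq [leRHS]big_seq; apply: lee_sum => v vsel.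
  rewrite mu_star // (EFinM packing_ratio) -muleA lee_pmul2l ?lte_fin //; last first.
    by rewrite mulr_gt0 ?exprn_gt0 // divr_gt0 // subr_gt0.
  exact: lowG (sel_sub v vsel).
rewrite -ge0_sume_distrr; last by move=> *; exact: measure_ge0.
rewrite lee_pmul2l // ?lte_fin; last first.
  by rewrite mulr_gt0 // mulr_gt0 ?exprn_gt0 // divr_gt0 // subr_gt0.
apply: sum_measure_disjoint_le => //.
- by move=> v; apply: measurableI => //; exact: measurable_slab.
- move=> v v' vs v's [z [[_ zv] [_ zv']]]; apply: sel_disj => //.
  by apply/orP; left; apply/asboolP; exists z.
Qed.

End parabolic_rectangles.

(** * The John-Nirenberg iteration *)

Section john_nirenberg.
Context {R : realType} {n : nat} (p gamma q : R) (N : nat).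
Local Notation ST := ('rV[R]_n * R)%type.
Local Notation mu := (@lebesgue_spacetime R n).
Local Notation P := (N%:R `^ p).
Local Notation beta := ((1 - gamma) / 2).
Local Notation wf := (cell_wf p beta).
Local Notation upper := (upper p gamma).
Local Notation lower := (lower p gamma).
Local Notation full := (full p).
Local Notation cupper := (cupper p gamma).
Local Notation clower := (clower p gamma).
Local Notation cfull := (cfull p).
Local Notation subcells := (subcells p beta N).
Implicit Types (g : ST -> R) (s : bool) (x : 'rV[R]_n) (l t a : R).

(* Weak-type form of the oscillation bound with constant 1 and centre [a]. *)
Definition centre s g x l t a := forall lam : R, 0 < lam ->
  (mu (upper s x l t `&` [set z | a + lam < g z]%R)
     <= (lam `^ (- q))%:E * mu (upper s x l t))%E /\
  (mu (lower s x l t `&` [set z | g z < a - lam]%R)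
     <= (lam `^ (- q))%:E * mu (lower s x l t))%E.

Definition ccentre s g (c : @pcell R n) a := centre s g (cc c) (cl c) (ctop p c) a.

Hypothesis p_gt0 : 0 < p.
Hypothesis gamma_gt0 : 0 < gamma.
Hypothesis gamma_lt1 : gamma < 1.
Hypothesis N_gt0 : (0 < N)%N.
Hypothesis P_large : 2 < beta * P.

Variables (s : bool) (g : ST -> R) (D : set ST).
Hypothesis mg : measurable_fun setT (g : spacetime R n -> R).
Hypothesis has_centre : forall x l t, 0 < l -> full s x l t `<=` D ->
  exists a, centre s g x l t a.

(** [A_large] makes [g] exceed [a + A / 2] on half of the lower part of a stopped rectangle.
    [Lam_large] leaves, after the factor 4 from upper part to cell, the proportion [1 / 2] of the
    density argument. In [eps_ge] the factors are: passing from a stopped cell to its parent, the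
    packing, and the weak-type bound at height [A / 2] on the root. *)
Variables (A Lam eps : R).
Hypothesis A_gt0 : 0 < A.
Hypothesis Lam_gt0 : 0 < Lam.
Hypothesis A_large : (A / 2) `^ (- q) <= 2^-1.
Hypothesis Lam_large : Lam `^ (- q) <= 8^-1.
Hypothesis eps_ge : @subcell_ratio R n p N *
  (@packing_ratio R n gamma * 2 * ((A / 2) `^ (- q) * 4)) <= eps.

Let eps_ge0 : 0 <= eps.
Proof.
apply: le_trans eps_ge; rewrite !mulr_ge0 ?powR_ge0 ?exprn_ge0 ?addr_ge0 ?powR_ge0 //.
by rewrite invr_ge0 subr_ge0 ltW.
Qed.

Let beta_gt0 : 0 < beta.
Proof. by rewrite divr_gt0 // subr_gt0. Qed.

Let measurable_gt a : measurable ([set z | a < g z] : set (spacetime R n)).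
Proof. exact: measurable_superlevelT. Qed.

Let measurable_lt a : measurable ([set z | g z < a] : set (spacetime R n)).
Proof. exact: measurable_sublevelT. Qed.

Let le_mu (E F : set (spacetime R n)) : measurable E -> measurable F ->
  E `<=` F -> (mu E <= mu F)%E.
Proof. by move=> mE mF EF; apply: le_measure; rewrite ?inE. Qed.

Let mU b : measurable (cset s b : set (spacetime R n)).
Proof. exact: measurable_cset. Qed.

Let sub_wf (b e : @pcell R n) : wf b -> e \in subcells b -> wf e.
Proof. by move=> wb eb; have [] := cell_wf_subcells gamma_gt0 gamma_lt1 N_gt0 P_large wb eb. Qed.

Let wf_pos (b : @pcell R n) : wf b -> cell_pos b.
Proof. exact: cell_wf_pos. Qed.

Let tree_sum bad k (c : @pcell R n) (E : set (spacetime R n)) : wf c -> measurable E ->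
  (\sum_(e <- max_bad subcells bad k c) mu (E `&` cset s e) <= mu (E `&` cset s c))%E.
Proof.
apply: max_bad_sum; first exact: sub_wf.
by move=> b F wb mF; apply: subcells_sum => //; exact: wf_pos.
Qed.

Let half_arith (m x y : \bar R) (h : R) : m \is a fin_num -> h <= 2^-1 ->
  (m <= x + y -> x <= h%:E * m -> 0 <= m -> m <= 2%:E * y)%E.
Proof.
move=> mfin hh mxy xm m0.
have {mxy} : (m <= 2^-1%:E * m + y)%E.
  apply: le_trans mxy _; apply: leeD2r; apply: le_trans xm _.
  by apply: lee_wpmul2r; rewrite ?lee_fin.
case: y => [y||]; last by rewrite addeNy; case: m mfin m0 {xm}.
  case: m mfin m0 {xm} => // m _ _; rewrite -!EFinM -EFinD !lee_fin; lra.
by move=> _; rewrite gt0_muley ?leey // lte_fin.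
Qed.

(** At most half of the lower part has [g < b - A / 2]; elsewhere [g] is at least [b - A / 2], which
    exceeds [a + A / 2]. *)
Let lower_large x l t a b (F : set (spacetime R n)) : 0 < l -> centre s g x l t b -> a + A < b ->
  measurable F -> lower s x l t `<=` F ->
  (mu (lower s x l t) <=
   2%:E * mu ((F `&` [set z | a + A / 2 < g z]%R) `&` lower s x l t))%E.
Proof.
move=> l0 cb ab mF lF; have mL : measurable (lower s x l t : set (spacetime R n)).
  exact: measurable_slab.
have mG : measurable (F `&` [set z | a + A / 2 < g z] : set (spacetime R n)).
  exact: measurableI.
have A2 : 0 < A / 2 by rewrite divr_gt0.
have [_ H] := cb (A / 2) A2.
apply: half_arith A_large _ H _ => //; first by rewrite mu_lower.
apply: le_trans (measureU2 _ _ _); try exact: measurableI.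
apply: le_mu => //; first by apply: measurableU; exact: measurableI.
move=> z Lz; have [zA|zA] := ltP (g z) (b - A / 2); [by left|right].
split=> //; split; first exact: lF.
by rewrite /=; lra.
Qed.

Lemma jn_decay k c a : wf c -> cfull s c `<=` D -> ccentre s g c a ->
  (mu (cset s c `&` [set z | a + k%:R * (A + Lam) < g z]%R)
     <= (eps ^+ k)%:E * mu (cset s c))%E.
Proof.
elim: k c a => [|k IH] c a wc cD ca.
  by rewrite expr0 mul1e; apply: le_mu => //; exact: measurableI.
have A0 := A_gt0; have L0 := Lam_gt0.
(* A rectangle has many centres; it is bad when none of them is at most [a + A]. *)
pose bad e := ~~ `[< exists2 b, ccentre s g e b & b <= a + A >].
have gc : ~~ bad c by rewrite negbK; apply/asboolP; exists a => //; rewrite lerDl ltW.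
(* Invariant of the subdivision: it keeps rectangles inside [D], where centres exist, and those of
   proper descendants inside the upper part of the root, where [ca] controls [g] from above. *)
pose Q d := wf d /\ (d = c \/ cfull s d `<=` cupper s c).
have Q_sub d e : Q d -> e \in subcells d -> Q e /\ cfull s e `<=` cupper s c.
  move=> [wd dc] ed.
  have ec : cfull s e `<=` cupper s c.
    have ed' := subcells_full gamma_gt0 gamma_lt1 N_gt0 P_large (s := s) wd ed.
    case: dc => [<-//|dc]; apply: subset_trans ed' (subset_trans _ dc).
    by apply: upper_full => //; rewrite ltW //; case: wd.
  by split => //; split; [exact: sub_wf ed|right].
have ccD : cupper s c `<=` D.
  by apply: subset_trans cD; apply: upper_full => //; rewrite ltW //; case: wc.
have QD d : Q d -> cfull s d `<=` D.
  by move=> [_ [->//|dc]]; exact: subset_trans ccD.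
have Qc : Q c by split => //; left.
pose S K := \big[setU/set0]_(b <- max_bad subcells bad K c) cset s b.
have mS K : measurable (S K : set (spacetime R n)) by exact: bigsetU_measurable.
pose E := [set z | a + k.+1%:R * (A + Lam) < g z] : set (spacetime R n).
have mE : measurable E by exact: measurable_gt.
have bad_info K b : b \in max_bad subcells bad K c ->
    [/\ wf b, cfull s b `<=` cupper s c, exists2 a_b, ccentre s g b a_b & a + A < a_b &
     (mu (E `&` cset s b) <= (eps ^+ k * @subcell_ratio R n p N)%:E * mu (cset s b))%E].
  move=> bK; have [bb [d [Qd gd bd]]] :=
    max_bad_parent (fun d e Qd ed => (Q_sub d e Qd ed).1) Qc gc bK.
  have [Qb bc] := Q_sub d b Qd bd; have [wb _] := Qb; have [wd _] := Qd.
  split => //.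
    have [a_b ab] := has_centre (proj1 wb) (QD _ Qb).
    exists a_b => //; rewrite ltNge; apply: contra bb => aA.
    by apply/asboolP; exists a_b.
  move: gd; rewrite negbK => /asboolP[a_d ad aA].
  (* The induction hypothesis is used on the parent [d]: its centre is at most [a + A], so one step
     of [A + Lam] lifts it past [a_d]. The stopped cell has no such upper bound on its centres. *)
  apply: (@le_trans _ _ (mu (cset s d `&` [set z | a_d + k%:R * (A + Lam) < g z]))).
    apply: le_mu; [exact: measurableI|exact: measurableI|].
    move=> z [Ez bz]; split; first exact: (subcells_sub N_gt0 (wf_pos wd) bd).
    apply: le_lt_trans Ez; rewrite -natr1 mulrDl mul1r.
    by lra.
  apply: le_trans (IH d a_d wd (QD _ Qd) ad) _.
  rewrite EFinM -muleA; apply: lee_wpmul2l; last exact: (mu_subcells gamma_lt1 N_gt0 s wd bd).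
  by rewrite lee_fin exprn_ge0.
have sum_bad K : (\sum_(b <- max_bad subcells bad K c) mu (cset s b)
    <= (@packing_ratio R n gamma * 2 * ((A / 2) `^ (- q) * 4))%:E * mu (cset s c))%E.
  have mC : measurable (cupper s c : set (spacetime R n)) by exact: measurable_slab.
  pose G := (cupper s c `&` [set z | a + A / 2 < g z]) : set (spacetime R n).
  have mG : measurable G by exact: measurableI.
  apply: le_trans (packing (G := G) p_gt0 gamma_gt0 gamma_lt1 _ _ _ _) _ => //.
  - by move=> b /bad_info[].
  - move=> F mF; apply: le_trans (tree_sum _ _ wc mF) _.
    by apply: le_mu => //; exact: measurableI.
  - move=> b /bad_info[[l0 _] bc [a_b ab aab] _].
    apply: (lower_large (b := a_b)) => //.
    by apply: subset_trans bc; apply: lower_full => //; exact: ltW.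
  rewrite [in leRHS]EFinM -muleA; apply: lee_wpmul2l.
    rewrite lee_fin !mulr_ge0 ?exprn_ge0 //.
    by rewrite invr_ge0 subr_ge0 ltW.
  have A2 : 0 < A / 2 by rewrite divr_gt0.
  have [H _] := ca (A / 2) A2.
  apply: le_trans H _; rewrite EFinM -muleA; apply: lee_wpmul2l.
    by rewrite lee_fin powR_ge0.
  exact: mu_upper_cset.
have stopped K : (mu (cset s c `&` E `&` S K) <= (eps ^+ k.+1)%:E * mu (cset s c))%E.
  apply: (@le_trans _ _ (\sum_(b <- max_bad subcells bad K c) mu (E `&` cset s b))%E).
    apply: (@le_trans _ _ (mu (\big[setU/set0]_(b <- max_bad subcells bad K c) (E `&` cset s b)))); last first.
      by apply: measure_bigsetU_le => b _; exact: measurableI.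
    apply: le_mu; first by apply: measurableI => //; exact: measurableI.
      by apply: bigsetU_measurable => b _; exact: measurableI.
    move=> z [[_ Ez]]; rewrite /S -!bigcup_seq => -[b bK bz].
    by exists b.
  apply: (@le_trans _ _ (\sum_(b <- max_bad subcells bad K c)
      (eps ^+ k * @subcell_ratio R n p N)%:E * mu (cset s b))%E).
    rewrite big_seq [leRHS]big_seq; apply: lee_sum => b bK.
    by have [] := bad_info K b bK.
  rewrite -ge0_sume_distrr; last by move=> *; exact: measure_ge0.
  have r0 : 0 <= eps ^+ k * @subcell_ratio R n p N.
    by rewrite !mulr_ge0 ?exprn_ge0 // addr_ge0 // powR_ge0.
  apply: le_trans (lee_wpmul2l _ (sum_bad K)) _; first by rewrite lee_fin.
  rewrite muleA -EFinM; apply: lee_wpmul2r; first exact: measure_ge0.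
  rewrite lee_fin exprSr -(mulrA (eps ^+ k) (@subcell_ratio R n p N)).
  by apply: ler_wpM2l; rewrite ?exprn_ge0.
(* The part not reached by stopping at any depth. A cell meeting [Z] is good, hence has a centre at
   most [a + A], and [g] exceeds [a + A + Lam] on at most half of it; so [Z] is null. *)
pose Z := (cset s c `&` [set z | a + (A + Lam) < g z]) `\` \bigcup_K S K.
have mZ : measurable (Z : set (spacetime R n)).
  by apply: measurableD; [exact: measurableI|exact: bigcup_measurable].
have Ufin : (mu (cset s c) < +oo)%E by rewrite mu_cset ?ltry //; exact: wf_pos.
have Z0 : mu Z = 0.
  apply: (@density_null _ _ _ mu _ (cset s) subcells wf mU sub_wf _ _ _ c Z wc _ mZ).
  - by move=> b z wb; apply: subcells_cover => //; exact: wf_pos.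
  - by move=> b e wb; apply: subcells_sub => //; exact: wf_pos.
  - by move=> b F wb; apply: subcells_sum => //; exact: wf_pos.
  - exact: Ufin.
  - by move=> z [[]].
  - move=> e e0; have Zc : Z `<=` cset s c by move=> z [[]].
    have [|| O [oO mO ZO leO]] := lebesgue_outer_regular (D := cset s c) _ _ Zc e0.
    + exact: borel_measurable_cell.
    + by rewrite -lebesgue_spacetime_borel //; exact: borel_measurable_cell.
    exists O; split => // z Zz; have [d d0 dO] := oO z (ZO z Zz).
    have [K small] := desc_small gamma_gt0 gamma_lt1 N_gt0 P_large wc d0.
    exists K => b bK [zx zt] w [wx wt]; have [sl st] := small b bK.
    apply: dO => [i|].
      by have := zx i; have := wx i; rewrite ltr_norml; lra.
    by move: zt wt; rewrite ltr_norml /otime; case: (s); lra.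
  - move=> K b bK [z [[[_ gz] nS] bz]].
    have wb : wf b by exact: desc_wf bK.
    have [[e eK ez]|gb] := max_bad_or_good sub_wf
        (fun b e wb => subcells_sub N_gt0 (wf_pos wb)) wc gc bK bz.
      by case: nS; exists K => //; rewrite /S -bigcup_seq; exists e.
    move: gb; rewrite negbK => /asboolP[a_b ab aA].
    have [H _] := ab Lam Lam_gt0.
    apply: (@le_trans _ _ (mu (cupper s b `&` [set z | a_b + Lam < g z]))).
      apply: le_mu; [exact: measurableI| |].
        by apply: measurableI => //; exact: measurable_slab.
      move=> w [[[_ gw] _] bw]; split; first exact: cset_upper.
      by move: gw; rewrite /=; lra.
    apply: le_trans H _.
    apply: le_trans (lee_wpmul2l _ (mu_upper_cset gamma_lt1 s wb)) _.
      by rewrite lee_fin powR_ge0.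
    rewrite muleA -EFinM; apply: lee_wpmul2r => //.
    by rewrite lee_fin; have := Lam_large; lra.
have mUE : measurable (cset s c `&` E : set (spacetime R n)) by exact: measurableI.
have mF K : measurable (cset s c `&` E `&` S K : set (spacetime R n)) by exact: measurableI.
have mUF : measurable (\bigcup_K (cset s c `&` E `&` S K) : set (spacetime R n)) by exact: bigcup_measurable.
apply: (@le_trans _ _ (mu (Z `|` \bigcup_K (cset s c `&` E `&` S K)))).
  apply: le_mu; [exact: measurableI|exact: measurableU|].
  move=> z [cz Ez]; have [zS|zS] := pselect ((\bigcup_K S K) z).
    by right; case: zS => K _ zK; exists K.
  left; split => //; split => //; apply: le_lt_trans Ez.
  rewrite lerD2l -[leLHS]mul1r; apply: ler_wpM2r; first by lra.
  by rewrite ler1n.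
apply: le_trans (measureU2 _ _ _) _ => //; rewrite [X in (X + _)%E]Z0 add0e.
apply: measure_bigcup_le => // K; apply: setIS => z.
by rewrite /S -!bigcup_seq => -[b bK bz]; exists b => //; exact: max_badS.
Qed.

End john_nirenberg.

(** * Chaining *)

Section chaining.
Context {R : realType} {n : nat} (p gamma q : R).
Local Notation ST := ('rV[R]_n * R)%type.
Local Notation mu := (@lebesgue_spacetime R n).
Local Notation centre := (@centre R n p gamma q).
Local Notation upper := (upper p gamma).
Local Notation lower := (lower p gamma).
Local Notation full := (full p).

Hypothesis gamma_gt0 : 0 < gamma.
Hypothesis gamma_lt1 : gamma < 1.
Variables (s : bool) (g : ST -> R).
Hypothesis mg : measurable_fun setT (g : spacetime R n -> R).
Variable Kap : R.
Hypothesis Kap_gt0 : 0 < Kap.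
(** The two exceptional sets are fractions [Kap^(-q)] of parts of measure [(2 l)^n (1 - gamma) l^p];
    the overlap has measure at least [l^n (1 - gamma) / 2 * l^p]. *)
Hypothesis Kap_large : Kap `^ (- q) * (4 * 2 ^+ n) < 1.

(* Otherwise two small level sets would cover the overlap of the lower part of
   the later rectangle with the upper part of the earlier one. *)
Lemma centre_step (x x' : 'rV[R]_n) (l t t' a a' : R) : 0 < l ->
  (forall i, `|x' ord0 i - x ord0 i| <= l) ->
  (1 + 3 * gamma) / 2 * l `^ p <= t' - t <= (1 + gamma) * l `^ p ->
  centre s g x l t a -> centre s g x' l t' a' -> a' <= a + 2 * Kap.
Proof.
move=> l0 xx tt ca ca'; have g0 := gamma_gt0; have g1 := gamma_lt1.
have lp := powR_gt0 p l0; have glp : gamma * l `^ p < l `^ p by rewrite gtr_pMl.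
rewrite leNgt; apply/negP => aa.
pose y : 'rV[R]_n := \row_i ((x ord0 i + x' ord0 i) / 2).
(* The cube of half-side [l / 2] about the midpoint lies in both cubes. The upper bound on [t' - t]
   gives the two inclusions in time, the lower one an overlap of duration at least
   [(1 - gamma) / 2 * l^p]. *)
pose B : set ST := slab s y (l / 2) (t + gamma * l `^ p) (t' - gamma * l `^ p).
have mB : measurable (B : set (spacetime R n)) by exact: measurable_slab.
have BU : B `<=` upper s x l t.
  apply: slab_sub => [i||]; [|by []|lra].
  by have := xx i; rewrite /y mxE ler_norml => ?; split; lra.
have BL : B `<=` lower s x' l t'.
  apply: slab_sub => [i||]; [|lra|by []].
  by have := xx i; rewrite /y mxE ler_norml => ?; split; lra.
have mgt b : measurable ([set z | b < g z] : set (spacetime R n)).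
  exact: measurable_superlevelT.
have mlt b : measurable ([set z | g z < b] : set (spacetime R n)).
  exact: measurable_sublevelT.
have [H1 _] := ca Kap Kap_gt0; have [_ H2] := ca' Kap Kap_gt0.
have mE1 : measurable (upper s x l t `&` [set z | a + Kap < g z] : set (spacetime R n)).
  by apply: measurableI => //; exact: measurable_slab.
have mE2 : measurable (lower s x' l t' `&` [set z | g z < a' - Kap] : set (spacetime R n)).
  by apply: measurableI => //; exact: measurable_slab.
have : (mu B <= (Kap `^ (- q))%:E * mu (upper s x l t) + (Kap `^ (- q))%:E * mu (lower s x' l t'))%E.
  apply: le_trans (leeD H1 H2); apply: le_trans (measureU2 _ mE1 mE2).
  apply: le_measure; rewrite ?inE //; first exact: measurableU.
  move=> z Bz; have [zK|zK] := ltP (a + Kap) (g z); [left|right]; split => //.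
  - exact: BU.
  - exact: BL.
  - by rewrite /=; lra.
rewrite mu_upper // mu_lower // lebesgue_slab; [|lra|lra].
rewrite -!EFinM -EFinD lee_fin; apply/negP; rewrite -ltNge.
have ln : 0 < l ^+ n by rewrite exprn_gt0.
have -> : 2 * (l / 2) = l by field.
rewrite exprMn; apply: (@lt_le_trans _ _ (l ^+ n * ((1 - gamma) / 2 * l `^ p))); last first.
  by apply: ler_wpM2l; [exact: ltW|lra].
have W0 : 0 < l ^+ n * ((1 - gamma) / 2 * l `^ p).
  by rewrite mulr_gt0 // mulr_gt0 // divr_gt0 // subr_gt0.
by have := Kap_large; rewrite -(ltr_pM2r W0); lra.
Qed.

(** Divide the space-time segment between the two centre points into [m] equal steps, each
    admissible for [centre_step]. Intermediate rectangles stay in the slab by convexity. *)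
Lemma centre_chain (x0 x x' : 'rV[R]_n) (L b1 b2 l t t' a : R) (m : nat) :
  (forall y l t, 0 < l -> full s y l t `<=` slab s x0 L b1 b2 ->
     exists a, centre s g y l t a) ->
  0 < l -> (0 < m)%N ->
  (forall i, `|x ord0 i - x0 ord0 i| <= L - l) ->
  (forall i, `|x' ord0 i - x0 ord0 i| <= L - l) ->
  b1 <= t - l `^ p -> t' + l `^ p <= b2 ->
  (forall i, `|x' ord0 i - x ord0 i| <= m%:R * l) ->
  m%:R * ((1 + 3 * gamma) / 2 * l `^ p) <= t' - t <= m%:R * ((1 + gamma) * l `^ p) ->
  centre s g x l t a ->
  exists2 a', centre s g x' l t' a' & a' <= a + m%:R * (2 * Kap).
Proof.
move=> cD l0 m0 xL x'L tb tb' xx tt ca.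
have g0 := gamma_gt0; have lp := powR_gt0 p l0.
have glp : 0 < gamma * l `^ p by rewrite mulr_gt0.
have mr : 0 < m%:R :> R by rewrite ltr0n.
pose d := (t' - t) / m%:R.
have dm : d * m%:R = t' - t by rewrite divfK // lt0r_neq0.
have d_bd : (1 + 3 * gamma) / 2 * l `^ p <= d <= (1 + gamma) * l `^ p.
  by rewrite ler_pdivlMr // ler_pdivrMr // ![_ * m%:R]mulrC.
have d0 : 0 <= d by lra.
pose e : 'rV[R]_n := \row_i ((x' ord0 i - x ord0 i) / m%:R).
have em i : e ord0 i * m%:R = x' ord0 i - x ord0 i.
  by rewrite mxE divfK // lt0r_neq0.
have el i : `|e ord0 i| <= l.
  by rewrite -(ler_pM2r mr) -[m%:R in leLHS]gtr0_norm // -normrM em mulrC.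
pose y (k : nat) : 'rV[R]_n := \row_i (x ord0 i + k%:R * e ord0 i).
suff step k : (k <= m)%N -> exists2 a', centre s g (y k) l (t + k%:R * d) a' &
    a' <= a + k%:R * (2 * Kap).
  have := step m (leqnn m); rewrite [m%:R * d]mulrC dm.
  have -> : y m = x'.
    by apply/rowP => i; rewrite mxE [m%:R * _]mulrC em; lra.
  by have -> : t + (t' - t) = t' by lra.
elim: k => [_|k IH km].
  exists a; last by rewrite mul0r addr0.
  have -> : y 0%N = x by apply/rowP => i; rewrite mxE mul0r addr0.
  by rewrite mul0r addr0.
have [a1 ca1 aa1] := IH (ltnW km).
have km' : k.+1%:R <= m%:R :> R by rewrite ler_nat.
have k0 : 0 <= k.+1%:R :> R by [].
have [a2 ca2] : exists a2, centre s g (y k.+1) l (t + k.+1%:R * d) a2.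
  apply: cD => //; apply: slab_sub => [i||].
  - have := xL i; have := x'L i; rewrite /y mxE !ler_norml => hx' hx.
    have -> : k.+1%:R * e ord0 i = k.+1%:R / m%:R * (x' ord0 i - x ord0 i).
      by rewrite /e mxE; ring.
    have : k.+1%:R / m%:R <= 1 :> R by rewrite ler_pdivrMr ?mul1r.
    have : 0 <= k.+1%:R / m%:R :> R by rewrite divr_ge0 // ltW.
    clear -hx hx'; move: (k.+1%:R / m%:R) => w w0 w1.
    (* The bounds at both ends, weighted by [w] and [1 - w], add up to the bound at the intermediate
       point. *)
    have h1 : 0 <= w * (L - l - x0 ord0 i + x' ord0 i) by rewrite mulr_ge0 //; lra.
    have h2 : 0 <= w * (L - l + x0 ord0 i - x' ord0 i) by rewrite mulr_ge0 //; lra.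
    have h3 : 0 <= (1 - w) * (L - l - x0 ord0 i + x ord0 i) by rewrite mulr_ge0 //; lra.
    have h4 : 0 <= (1 - w) * (L - l + x0 ord0 i - x ord0 i) by rewrite mulr_ge0 //; lra.
    by split; lra.
  - have : 0 <= k.+1%:R * d by rewrite mulr_ge0.
    lra.
  - have : k.+1%:R * d <= m%:R * d by rewrite ler_wpM2r.
    by rewrite [m%:R * d]mulrC dm; lra.
exists a2 => //.
have : a2 <= a1 + 2 * Kap.
  apply: centre_step ca1 ca2 => // [i|].
    have -> : y k.+1 ord0 i - y k ord0 i = e ord0 i by rewrite !mxE -natr1; ring.
    exact: el.
  have -> : t + k.+1%:R * d - (t + k%:R * d) = d by rewrite -natr1; ring.
  by [].
by move: aa1; rewrite -natr1; lra.
Qed.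

End chaining.

(** * Decay on a whole upper part, with the shortened time lag *)

Section upper_part_decay.
Context {R : realType} {n : nat} (p gamma q : R) (N : nat).
Local Notation ST := ('rV[R]_n * R)%type.
Local Notation mu := (@lebesgue_spacetime R n).
Local Notation P := (N%:R `^ p).
Local Notation beta := ((1 - gamma) / 2).
Local Notation wf := (cell_wf p beta).
Local Notation full := (full p).
Local Notation centre := (@centre R n p gamma q).
Local Notation subcells := (subcells p beta N).

(** The whole part between heights [rho] and 1 is treated as one cell and subdivided once; only its
    children are well formed and start the iteration. *)
Lemma part_subcells (x0 : 'rV[R]_n) (L t0 rho : R) (e : @pcell R n) :
  gamma < 1 -> (0 < N)%N -> 1 <= P -> rho <= gamma -> 0 < L ->
  e \in subcells (x0, L, t0 + rho * L `^ p, (1 - rho) * L `^ p) -> [/\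
    cl e = L / N%:R, wf e,
    forall i, x0 ord0 i - L <= cc e ord0 i - cl e /\ cc e ord0 i + cl e <= x0 ord0 i + L,
    t0 + rho * L `^ p - cl e `^ p <= ctop p e & ctop p e + cl e `^ p <= t0 + L `^ p].
Proof.
move=> g1 N0 P1 rg L0; set c : @pcell R n := (x0, L, _, _) => ec.
have Nr : 0 < N%:R :> R by rewrite ltr0n.
have P0 : 0 < P by exact: powR_gt0.
have Lp : 0 < L `^ p by exact: powR_gt0.
have rho1 : rho < 1 by exact: le_lt_trans g1.
have b0 : 0 < beta by rewrite divr_gt0 // subr_gt0.
have br : beta <= 1 - rho by clear -rg g1; lra.
have pc : cell_pos c by split => //; rewrite /ct /= mulr_gt0 // subr_gt0.
have betah : beta * (cl c / N%:R) `^ p <= ct c.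
  rewrite powR_div ?(ltW L0) // mulrA ler_pdivrMr //.
  apply: (@le_trans _ _ ((1 - rho) * L `^ p)); first by rewrite ler_pM2r.
  by rewrite ler_peMr // mulr_ge0 // ltW // subr_gt0.
have [we _] := subcells_wf N0 b0 (c := c) L0 betah ec.
have [H1 H2 H3 H4] := subcells_bounds N0 pc ec.
have [_ te] := cell_wf_pos b0 we.
split => //; first exact: subcells_cl ec.
- by move: H3; have -> : cb c = t0 + rho * L `^ p by []; rewrite /ctop; clear -te; lra.
- move: H4; have -> : cb c + ct c = t0 + L `^ p by rewrite /cb /ct /=; ring.
  by rewrite /ctop subrK.
Qed.

(** Take the least integer above [d / w], with [w] the longest admissible step. Rounding up
    overshoots by at most [w <= 2 h], while longest and shortest steps differ by
    [(1 - gamma) / 2 * h], so [m >= N] links give at least [2 h] of slack. [N <= m] also lets the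
    chain cross the cube. *)
Lemma chain_length (h d : R) : 0 < gamma -> gamma < 1 -> (0 < N)%N -> 0 < h ->
  4 <= (1 - gamma) * N%:R -> (3 * N%:R - 1) * h <= d -> d <= 2 * P * h ->
  exists m : nat, [/\ (0 < m)%N, N%:R <= m%:R :> R, m%:R <= 2 * P + 1 &
    m%:R * ((1 + 3 * gamma) / 2 * h) <= d <= m%:R * ((1 + gamma) * h)].
Proof.
move=> g0 g1 N0 h0 N4 d1 d2.
have Nr : 0 < N%:R :> R by rewrite ltr0n.
have N1 : 1 <= N%:R :> R by rewrite ler1n.
have P0 : 0 < P by exact: powR_gt0.
pose w := (1 + gamma) * h.
have w0 : 0 < w by rewrite mulr_gt0 // addr_gt0.
have y1 : N%:R <= d / w.
  rewrite ler_pdivlMr //; apply: le_trans d1.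
  have Nh : 0 <= (1 - gamma) * (N%:R * h) by rewrite !mulr_ge0 ?subr_ge0 // ltW.
  have : 1 * h <= N%:R * h by rewrite ler_pM2r.
  by rewrite /w; clear -Nh; lra.
have y2 : d / w <= 2 * P.
  rewrite ler_pdivrMr //; apply: le_trans d2 _.
  by rewrite ler_pM2l ?mulr_gt0 // /w ler_peMl ?(ltW h0) // lerDl ltW.
have dE : d = d / w * w by rewrite divfK // lt0r_neq0.
have y0 : 0 <= d / w by apply: le_trans y1.
have /andP[my ym] := truncn_itv y0.
exists (Num.truncn (d / w)).+1; move: my ym; rewrite -[_.+1%:R]natr1.
set m := (Num.truncn _)%:R; move: dE y1 y2; set y := d / w => dE y1 y2 my ym.
have mN : N%:R <= m + 1 by apply: le_trans y1 (ltW ym).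
split => //; first by rewrite lerD2r (le_trans my).
apply/andP; split; last by rewrite dE ler_pM2r // ltW.
have mw : (m + 1) * w <= (y + 1) * w by rewrite ler_pM2r // lerD2r.
have gh : gamma * h <= h by rewrite ger_pMl // ltW.
have mh : 4 * h <= (1 - gamma) * (m + 1) * h.
  by rewrite ler_pM2r // (le_trans N4) // ler_pM2l ?subr_gt0.
by move: mw mh gh; rewrite dE /w; clear; lra.
Qed.

(* [mid] and [rho] are the relative heights, in a rectangle, of the reference
   rectangle of side [L / N] and of the bottom of the upper part. *)
Lemma upper_decay (s : bool) (g : ST -> R) (x0 : 'rV[R]_n) (L t0 rho mid A Lam eps Kap a : R)
    (k : nat) :
  0 < p -> 0 < gamma -> gamma < 1 -> (0 < N)%N -> 2 < beta * P ->
  4 <= (1 - gamma) * N%:R -> rho <= gamma -> 2 <= (1 + rho) * P ->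
  3 * N%:R <= (rho - mid) * P -> 1 <= (1 + mid) * P ->
  0 < A -> 0 < Lam -> (A / 2) `^ (- q) <= 2^-1 -> Lam `^ (- q) <= 8^-1 ->
  @subcell_ratio R n p N * (@packing_ratio R n gamma * 2 * ((A / 2) `^ (- q) * 4)) <= eps ->
  0 < Kap -> Kap `^ (- q) * (4 * 2 ^+ n) < 1 ->
  measurable_fun setT (g : spacetime R n -> R) -> 0 < L ->
  (forall x l t, 0 < l -> full s x l t `<=` full s x0 L t0 -> exists a, centre s g x l t a) ->
  centre s g x0 (L / N%:R) (t0 + mid * L `^ p) a ->
  (mu (cell s x0 L (t0 + rho * L `^ p)%R (t0 + L `^ p)%R `&`
     [set z | a + (2 * P + 1) * (2 * Kap) + k%:R * (A + Lam) < g z]%R)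
   <= (eps ^+ k)%:E * mu (cell s x0 L (t0 + rho * L `^ p)%R (t0 + L `^ p)%R))%E.
Proof.
move=> p0 g0 g1 N0 PL N4 rg r2 rm m1 A0 L0 A2 L8 epsP K0 K2 mg L_gt0 has_centre ca.
have Nr : 0 < N%:R :> R by rewrite ltr0n.
have N1 : 1 <= N%:R :> R by rewrite ler1n.
have P0 : 0 < P by exact: powR_gt0.
have Lp : 0 < L `^ p by exact: powR_gt0.
have P1 : 1 <= P by clear -g0 P0 PL; nra.
have h0 : 0 < (L / N%:R) `^ p by rewrite powR_gt0 // divr_gt0.
have LpE : L `^ p = P * (L / N%:R) `^ p.
  by rewrite powR_div ?(ltW L_gt0) // mulrC divfK // lt0r_neq0.
pose c : @pcell R n := (x0, L, t0 + rho * L `^ p, (1 - rho) * L `^ p).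
have -> : cell s x0 L (t0 + rho * L `^ p) (t0 + L `^ p) = cset s c.
  by rewrite /cset /cc /cl /cb /ct /c /=; congr (cell _ _ _ _ _); ring.
have pc : cell_pos c.
  by split => //; rewrite /ct /= mulr_gt0 // subr_gt0 (le_lt_trans rg).
have info e : e \in subcells c -> _ := part_subcells g1 N0 P1 rg L_gt0.
move: h0 LpE info; set h := (L / N%:R) `^ p => h0 LpE info.
have r2h : 2 * h <= (1 + rho) * P * h by rewrite ler_pM2r.
have rmh : 3 * N%:R * h <= (rho - mid) * P * h by rewrite ler_pM2r.
have m1h : 1 * h <= (1 + mid) * P * h by rewrite ler_pM2r.
have sub_wf e : e \in subcells c -> wf e by move=> /info[].
have sub_full e : e \in subcells c -> cfull p s e `<=` full s x0 L t0.
  move=> /info[le _ xe]; rewrite le -/h LpE => te1 te2.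
  apply: slab_sub => [i||]; first exact: xe.
    by rewrite le -/h LpE; clear -te1 r2h; lra.
  by rewrite le -/h LpE.
have sub_centre e : e \in subcells c -> exists2 a', ccentre p gamma q s g e a' &
    a' <= a + (2 * P + 1) * (2 * Kap).
  move=> /info[le _ xe te1 te2].
  pose d := ctop p e - (t0 + mid * L `^ p).
  have d1 : (3 * N%:R - 1) * h <= d.
    by move: te1; rewrite /d le -/h LpE; clear -rmh; lra.
  have d2 : d <= 2 * P * h.
    by move: te2; rewrite /d le -/h LpE; clear -m1h h0; lra.
  have [m [m0 mN mP md]] := chain_length g0 g1 N0 h0 N4 d1 d2.
  have le0 : 0 < cl e by rewrite le divr_gt0.
  have [|||||||a' ca' aa'] := @centre_chain R n p gamma q g0 g1 s g mg Kap K0 K2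
      x0 x0 (cc e) L (t0 - L `^ p) (t0 + L `^ p) (cl e)
      (t0 + mid * L `^ p) (ctop p e) a m has_centre le0 m0.
  - move=> i; rewrite subrr normr0 subr_ge0 le ler_pdivrMr //.
    by rewrite ler_peMr // ltW.
  - by move=> i; have [] := xe i; rewrite ler_norml; clear; lra.
  - by rewrite le -/h LpE; clear -m1h h0; lra.
  - exact: te2.
  - move=> i; apply: (@le_trans _ _ L).
      by have [] := xe i; rewrite ler_norml; clear -le0; lra.
    by rewrite le mulrA ler_pdivlMr // mulrC ler_pM2r.
  - by rewrite -/d le.
  - by rewrite le.
  exists a' => //; apply: le_trans aa' _.
  by rewrite lerD2l ler_pM2r ?mulr_gt0.
set b := a + (2 * P + 1) * (2 * Kap).
have mE : measurable ([set z | b + k%:R * (A + Lam) < g z] : set (spacetime R n)).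
  exact: measurable_superlevelT.
set E := [set z | _] in mE *.
have eps0 : 0 <= eps.
  apply: le_trans epsP; apply: mulr_ge0.
    by apply: mulr_ge0; rewrite ?exprn_ge0 // addr_ge0 // powR_ge0.
  rewrite mulr_ge0 // mulr_ge0 ?powR_ge0 // mulr_ge0 ?exprn_ge0 //.
  by rewrite divr_ge0 // subr_ge0 ltW.
have mU e : measurable (cset s e : set (spacetime R n)) by exact: measurable_cset.
apply: (@le_trans _ _ (\sum_(e <- subcells c) mu (E `&` cset s e))%E).
  apply: (@le_trans _ _ (mu (\big[setU/set0]_(e <- subcells c) (E `&` cset s e)))); last first.
    by apply: measure_bigsetU_le => e _; exact: measurableI.
  apply: le_measure; rewrite ?inE //; first exact: measurableI.
    by apply: bigsetU_measurable => e _; exact: measurableI.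
  move=> z [cz Ez]; have [e ec ez] := subcells_cover p beta N0 pc cz.
  by rewrite -bigcup_seq; exists e.
apply: (@le_trans _ _ (\sum_(e <- subcells c) (eps ^+ k)%:E * mu (setT `&` cset s e))%E).
  rewrite big_seq [leRHS]big_seq; apply: lee_sum => e ec; rewrite setTI.
  have [a' ca' aa'] := sub_centre e ec.
  apply: le_trans (jn_decay p0 g0 g1 N0 PL mg has_centre A0 L0 A2 L8 epsP k (sub_wf e ec) (sub_full e ec) ca').
  apply: le_measure; rewrite ?inE; [exact: measurableI| |].
    by apply: measurableI => //; exact: measurable_superlevelT.
  by move=> z [Ez ez]; split => //; apply: le_lt_trans Ez; rewrite lerD2r.
rewrite -ge0_sume_distrr; last by move=> *; exact: measure_ge0.
apply: lee_wpmul2l; first by rewrite lee_fin exprn_ge0.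
apply: le_trans (subcells_sum p beta N0 s pc measurableT) _.
by rewrite setTI.
Qed.

End upper_part_decay.

(** * From level sets to moments *)

Section layer_cake.
Context d (T : measurableType d) (R : realType) (mu : {measure set T -> \bar R}).

(** By [k + 1 <= 2^k]. The decay rate [2^(-(r+1))] is chosen to beat the growth [2^(k r)] of the
    levels and leave a geometric series. *)
Lemma layer_coef (r : R) (k : nat) : 0 < r ->
  k.+1%:R `^ r * (2 `^ (- (r + 1))) ^+ k <= (2 ^+ k)^-1 :> R.
Proof.
move=> r0.
have h1 : k.+1%:R `^ r <= (2 ^+ k) `^ r :> R.
  apply: ge0_ler_powR; rewrite ?nnegrE ?(ltW r0) ?exprn_ge0 //.
  by rewrite -natrX ler_nat ltn_expl.
have -> : (2 ^+ k)^-1 = (2 ^+ k) `^ r * (2 `^ (- (r + 1))) ^+ k :> R.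
  rewrite -[X in X `^ r]powR_mulrn // -powR_mulrn ?powR_ge0 // -!powRrM.
  rewrite -powRD ?pnatr_eq0 ?implybT //.
  rewrite (_ : _ + _ = - k%:R); last by ring.
  by rewrite powRN powR_mulrn.
by apply: ler_wpM2r => //; rewrite exprn_ge0 // powR_ge0.
Qed.

(** With [k] the last level such that [k B < u], the term [(B (k + 1))^r] of the sum over levels
    already dominates [u^r]. *)
Lemma layer_cake (U : set T) (u : T -> R) (r B K : R) : measurable U ->
  mu U \is a fin_num ->
  measurable_fun U u -> 0 < r -> 0 < B -> 0 <= K ->
  (forall k : nat, (mu (U `&` [set z | k%:R * B < u z]%R) <=
     (K * (2 `^ (- (r + 1))) ^+ k)%:E * mu U)%E) ->
  (\int[mu]_(z in U) ((u^\+ z) `^ r)%:E <= (2 * K * B `^ r)%:E * mu U)%E.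
Proof.
move=> mU fU mu_u r0 B0 K0 Hk.
have mA k : measurable (U `&` [set z | k%:R * B < u z]).
  exact: measurable_superlevel.
pose F (k : nat) (z : T) : \bar R :=
  ((B * k.+1%:R) `^ r * \1_(U `&` [set z | k%:R * B < u z]) z)%:E.
have F0 k z : (0 <= F k z)%E by rewrite lee_fin mulr_ge0 // powR_ge0.
have mF k : measurable_fun U (F k).
  apply/measurable_EFinP; apply: measurable_funM => //.
have mur : measurable_fun U (fun z => ((u^\+ z) `^ r)%:E).
  apply/measurable_EFinP.
  apply: (measurableT_comp (measurable_powR r)).
  exact: measurable_funrpos.
apply: (@le_trans _ _ (\int[mu]_(z in U) \sum_(k <oo) F k z)%E).
  apply: ge0_le_integral => //.
  - by move=> z _; rewrite lee_fin powR_ge0.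
  - by apply: ge0_emeasurable_sum => //= k z _; exact: F0.
  move=> z Uz; have [uz|uz] := leP (u z) 0.
    rewrite /funrpos (max_idPr uz) powR0 ?lt0r_neq0 //.
    by apply: nneseries_ge0 => *; exact: F0.
  have exk : exists k : nat, u z <= k.+1%:R * B.
    exists (Num.truncn (u z / B)); rewrite -ler_pdivrMr // ltW //.
    exact: truncnS_gt.
  case: (ex_minnP exk) => k uk kmin.
  have ku : k%:R * B < u z.
    case: k kmin {uk} => [|k] kmin; first by rewrite mul0r.
    by rewrite ltNge; apply/negP => /kmin; rewrite ltnn.
  apply: (@le_trans _ _ (F k z)).
    rewrite lee_fin indicE mem_set // mulr1 /funrpos (max_idPl (ltW uz)).
    by apply: ge0_ler_powR; rewrite ?nnegrE ?(ltW r0) ?(ltW uz) ?mulr_ge0 ?(ltW B0) // mulrC.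
  apply: le_trans (nneseries_lim_ge k.+1 _); last by move=> *; exact: F0.
  by rewrite big_nat_recr //= leeDr // sume_ge0.
rewrite integral_nneseries //.
(* The factor [2 / 2^(k+1)] is [2^(-k)] in the shape summed by [epsilon_trick0]. *)
have leF k : (\int[mu]_(z in U) F k z <= (2 * (K * B `^ r) / (2 ^ k.+1)%:R)%:E * mu U)%E.
  under eq_integral do rewrite /F EFinM.
  rewrite ge0_integralZl_EFin ?powR_ge0 //; last first.
    by apply/measurable_EFinP; exact: measurable_indic.
  rewrite integral_indic // setIAC setIid.
  apply: le_trans (lee_wpmul2l _ (Hk k)) _; first by rewrite lee_fin powR_ge0.
  rewrite muleA -EFinM; apply: lee_wpmul2r => //; rewrite lee_fin.
  rewrite powRM ?(ltW B0) //.
  have := layer_coef k r0; rewrite natrX exprS.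
  have KB : 0 <= K * B `^ r by rewrite mulr_ge0 // powR_ge0.
  move=> /(ler_wpM2l KB) H.
  have -> : 2 * (K * B `^ r) / (2 * 2 ^+ k) = K * B `^ r * (2 ^+ k)^-1.
    by field; rewrite expf_neq0.
  by apply: le_trans H; rewrite le_eqVlt; apply/orP; left; apply/eqP; ring.
apply: (@le_trans _ _ (\sum_(k <oo) (2 * (K * B `^ r) / (2 ^ k.+1)%:R)%:E * mu U)%E).
  by apply: lee_nneseries => [k _ _|k _]; [apply: integral_ge0 => z _; exact: F0|exact: leF].
have KB : 0 <= 2 * (K * B `^ r) by rewrite !mulr_ge0 // powR_ge0.
have muU : (0 <= mu U)%E by [].
rewrite -(fineK fU) in muU *; under eq_eseriesr do rewrite muleC.
rewrite nneseriesZl; last by move=> k _; rewrite lee_fin divr_ge0.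
rewrite muleC -mulrA; apply: lee_wpmul2r => //.
exact: (epsilon_trick0 xpredT KB).
Qed.

End layer_cake.

Section power_integrals.
Context d (T : measurableType d) (R : realType) (mu : {measure set T -> \bar R}).

Let measurable_pos_powR (E : set T) (u : T -> R) (q : R) : measurable_fun E u ->
  measurable_fun E (fun z => ((u^\+ z) `^ q)%:E).
Proof.
move=> mf; apply/measurable_EFinP; apply: (measurableT_comp (measurable_powR q)).
exact: measurable_funrpos.
Qed.

Lemma integral_scale_powR (E : set T) (u v : T -> R) (M r : R) : measurable E ->
  measurable_fun E v -> 0 < M -> (forall z, E z -> u z = M * v z) ->
  (\int[mu]_(z in E) ((u^\+ z) `^ r)%:E =
   (M `^ r)%:E * \int[mu]_(z in E) ((v^\+ z) `^ r)%:E)%E.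
Proof.
move=> mE mv M0 uv; rewrite -ge0_integralZl_EFin ?powR_ge0 //.
- apply: eq_integral => z; rewrite inE => Ez; rewrite -EFinM -powRM ?(ltW M0) //.
  by rewrite /funrpos uv // maxr_pMr ?(ltW M0) // mulr0.
- by move=> z _; rewrite lee_fin powR_ge0.
- exact: measurable_pos_powR.
Qed.

Lemma chebyshev_powR (E : set T) (u : T -> R) (q M lam : R) : measurable E ->
  measurable_fun E u -> 0 < q -> 0 < M -> 0 < lam ->
  (\int[mu]_(z in E) ((u^\+ z) `^ q)%:E <= (M `^ q)%:E * mu E)%E ->
  (mu (E `&` [set z | lam * M < u z]%R) <= (lam `^ (- q))%:E * mu E)%E.
Proof.
move=> mE mf q0 M0 lam0 intE.
pose A := E `&` [set z | lam * M < u z].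
have mA : measurable A.
  exact: measurable_superlevel.
have AE : A `<=` E by exact: subIsetl.
have lMq : 0 < (lam * M) `^ q by rewrite powR_gt0 // mulr_gt0.
have : (((lam * M) `^ q)%:E * mu A <= (M `^ q)%:E * mu E)%E.
  apply: le_trans intE; rewrite -integral_cst //.
  apply: (@le_trans _ _ (\int[mu]_(z in A) ((u^\+ z) `^ q)%:E)%E); last first.
    apply: ge0_subset_integral => //; first exact: measurable_pos_powR.
    by move=> z _; rewrite lee_fin powR_ge0.
  apply: ge0_le_integral => //.
  - by move=> z _; rewrite /= lee_fin ltW.
  - by apply: measurable_pos_powR; exact: measurable_funS mf.
  move=> z [_ /= uz]; rewrite lee_fin.
  have u0 : 0 < u z by apply: lt_trans uz; rewrite mulr_gt0.
  rewrite /funrpos (max_idPl (ltW u0)); apply: ge0_ler_powR; rewrite ?nnegrE ?ltW //.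
  by rewrite mulr_gt0.
rewrite -lee_pdivlMl // muleA -EFinM.
rewrite (_ : _^-1 * _ = lam `^ (- q)) //.
rewrite powRM ?ltW // powRN invfM -mulrA mulVf ?mulr1 //.
by rewrite lt0r_neq0 // powR_gt0.
Qed.

(* Pointwise, [u^q <= M^q (1 + (u / M)^r)] as [q <= r]. *)
Lemma power_mean_subset (E F : set T) (u : T -> R) (q r M K : R) : measurable E ->
  measurable F -> E `<=` F -> measurable_fun F u -> 0 < q -> q <= r -> 0 < M -> 0 <= K ->
  (mu F = K%:E * mu E)%E ->
  (\int[mu]_(z in F) ((u^\+ z) `^ r)%:E <= (M `^ r)%:E * mu F)%E ->
  (\int[mu]_(z in E) ((u^\+ z) `^ q)%:E <= ((1 + K) * M `^ q)%:E * mu E)%E.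
Proof.
move=> mE mF EF mu_ q0 qr M0 K0 KE intF.
have Mq := powR_gt0 q M0; have Mr := powR_gt0 r M0.
have muE : measurable_fun E u by exact: measurable_funS mu_.
have mEr := measurable_pos_powR r muE.
have r0 : 0 < r by exact: lt_le_trans qr.
apply: (@le_trans _ _ (\int[mu]_(z in E) ((M `^ q)%:E + (M `^ q / M `^ r)%:E * ((u^\+ z) `^ r)%:E))%E).
  apply: ge0_le_integral => //.
  - by move=> z _; rewrite lee_fin powR_ge0.
  - exact: measurable_pos_powR.
  - apply: emeasurable_funD => //.
    by apply: measurable_funeM.
  move=> z _; rewrite -EFinM -EFinD lee_fin.
  have v0 : 0 <= u^\+ z by exact: funrpos_ge0.
  move: (u^\+ z) v0 => v v0; have vr := powR_ge0 v r.
  have [vM|Mv] := leP v M.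
    apply: (@le_trans _ _ (M `^ q)); last by rewrite lerDl !mulr_ge0 // ?invr_ge0 ltW.
    by apply: ge0_ler_powR; rewrite ?nnegrE ?(ltW q0) ?(ltW M0).
  apply: (@le_trans _ _ (M `^ q / M `^ r * v `^ r)); last by rewrite lerDr ltW.
  have vM1 : 1 <= v / M by rewrite ler_pdivlMr // mul1r ltW.
  have := ler_powR vM1 qr; rewrite !powR_div // ler_pdivrMr // => H.
  by apply: le_trans H _; rewrite le_eqVlt; apply/orP; left; apply/eqP; ring.
rewrite ge0_integralD //; first last.
- by apply: measurable_funeM.
- by move=> z _; rewrite -EFinM lee_fin !mulr_ge0 ?invr_ge0 ?powR_ge0.
- by move=> z _; rewrite lee_fin ltW.
rewrite integral_cst // ge0_integralZl_EFin //; first last.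
- by rewrite mulr_ge0 ?invr_ge0 ?powR_ge0.
- by move=> z _; rewrite lee_fin powR_ge0.
have H : (\int[mu]_(z in E) ((u^\+ z) `^ r)%:E <= (M `^ r)%:E * mu F)%E.
  apply: le_trans intF; apply: ge0_subset_integral => //.
  - exact: measurable_pos_powR.
  - by move=> z _; rewrite lee_fin powR_ge0.
apply: le_trans (leeD2l _ (lee_wpmul2l _ H)) _.
  by rewrite lee_fin mulr_ge0 ?invr_ge0 ?powR_ge0.
rewrite KE muleA -EFinM muleA -EFinM -ge0_muleDl ?lee_fin; first last.
- by rewrite mulr_ge0 // mulr_ge0 ?powR_ge0 // mulr_ge0 ?invr_ge0 ?powR_ge0.
- exact: ltW.
rewrite divfK ?lt0r_neq0 // -EFinD.
by rewrite [(1 + K) * _]mulrDl mul1r [K * _]mulrC.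
Qed.

End power_integrals.

(** * Averages, oscillation and norm *)

Section averages.
Context {R : realType} {n : nat}.
Local Notation ST := ('rV[R]_n * R)%type.
Local Notation mu := (@lebesgue_spacetime R n).

Lemma average_le_integral (E : set ST) (h : ST -> \bar R) (m a : R) :
  0 < m -> mu E = m%:E ->
  (average E h <= a%:E)%E -> (\int[mu]_(z in E) h z <= a%:E * mu E)%E.
Proof.
move=> m0 mE; rewrite /average mE inver (negbTE (lt0r_neq0 m0)).
by rewrite lee_pdivrMl // muleC.
Qed.

Lemma integral_le_average (E : set ST) (h : ST -> \bar R) (m a : R) :
  0 < m -> mu E = m%:E ->
  (\int[mu]_(z in E) h z <= a%:E * mu E)%E -> (average E h <= a%:E)%E.
Proof.
move=> m0 mE; rewrite /average mE inver (negbTE (lt0r_neq0 m0)).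
by rewrite lee_pdivrMl // muleC.
Qed.

Lemma average_ge0 (E : set ST) (h : ST -> \bar R) : (forall z, 0 <= h z)%E ->
  (0 <= average E h)%E.
Proof.
by move=> h0; rewrite mule_ge0 // ?inve_ge0 //; exact: integral_ge0.
Qed.

(** The strict inequality provides an actual constant [c], although the infimum need not be
    attained. *)
Lemma PBMO_osc_lt (p gamma delta q M : R) (f : ST -> R) x t L : 0 < q -> 0 < M ->
  (PBMO_osc p gamma delta q f x t L < M%:E)%E -> exists c : R,
  (average (prect_up p gamma x t L) (fun z => ((fun w => f w - c)^\+ z `^ q)%:E) <= (M `^ q)%:E)%E /\
  (average (prect_low p delta x t L) (fun z => ((fun w => f w - c)^\- z `^ q)%:E) <= (M `^ q)%:E)%E.
Proof.
move=> q0 M0 /ereal_inf_lt[_ [c _ <-]] XYM; exists c; move: XYM.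
set X := average _ _; set Y := average _ _ => XYM.
have X0 : (0 <= X)%E by apply: average_ge0 => z; rewrite lee_fin powR_ge0.
have Y0 : (0 <= Y)%E by apply: average_ge0 => z; rewrite lee_fin powR_ge0.
move: X Y X0 Y0 XYM => X Y X0 Y0 XYM.
suff XY : (X + Y <= (M `^ q)%:E)%E.
  by split; apply: le_trans XY; [rewrite leeDl|rewrite leeDr].
have : (0 <= X + Y)%E by exact: adde_ge0.
move: (X + Y)%E XYM => [v|//|//]; last by rewrite poweRyr ?invr_neq0 ?lt0r_neq0.
rewrite poweR_EFin lte_fin !lee_fin => vM v0.
have -> : v = (v `^ q^-1) `^ q by rewrite -powRrM mulVf ?lt0r_neq0 // powRr1.
by apply: ge0_ler_powR; rewrite ?nnegrE ?powR_ge0 // ltW.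
Qed.

Lemma PBMO_osc_le (p gamma delta q a b c : R) (f : ST -> R) x t L : 0 < q ->
  (average (prect_up p gamma x t L) (fun z => ((fun w => f w - c)^\+ z `^ q)%:E) <= a%:E)%E ->
  (average (prect_low p delta x t L) (fun z => ((fun w => f w - c)^\- z `^ q)%:E) <= b%:E)%E ->
  (PBMO_osc p gamma delta q f x t L <= ((a + b) `^ q^-1)%:E)%E.
Proof.
move=> q0.
have key (X Y : \bar R) : (0 <= X)%E -> (0 <= Y)%E -> (X <= a%:E)%E -> (Y <= b%:E)%E ->
    ((X + Y) `^ q^-1 <= ((a + b) `^ q^-1)%:E)%E.
  move=> X0 Y0 Xa Yb; rewrite -poweR_EFin; apply: gt0_ler_poweR.
  - by rewrite invr_ge0 ltW.
  - by rewrite in_itv /= adde_ge0 // leey.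
  - rewrite in_itv /= leey andbT EFinD; apply: adde_ge0.
      exact: le_trans Xa.
    exact: le_trans Yb.
  - by rewrite EFinD leeD.
move=> Xa Yb; apply: le_trans (ereal_inf_lbound _) _; first by exists c.
by apply: key Xa Yb; apply: average_ge0 => z; rewrite lee_fin powR_ge0.
Qed.

Lemma PBMO_osc_ge0 (p gamma delta q : R) (f : ST -> R) x t L :
  (0 <= PBMO_osc p gamma delta q f x t L)%E.
Proof. by apply: le_ereal_inf_tmp => _ [c _ <-]; exact: poweR_ge0. Qed.

Lemma PBMO2_norm_le (p gamma delta q gamma' delta' q' C : R) (D : set ST) (f : ST -> R) :
  0 < C ->
  (forall x t L M, 0 < L -> 0 < M -> prect p x t L `<=` D ->
     (PBMO2_norm p gamma' delta' q' D f < M%:E)%E ->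
     (PBMO_osc p gamma delta q f x t L <= (C * M)%:E)%E) ->
  (PBMO2_norm p gamma delta q D f <= C%:E * PBMO2_norm p gamma' delta' q' D f)%E.
Proof.
move=> C0 H; apply: ge_ereal_sup => _ [x [t [L [L0 RD ->]]]].
(* A supremum over no rectangles would be [-oo]; the rectangle at hand excludes this. *)
have : (0 <= PBMO2_norm p gamma' delta' q' D f)%E.
  apply: le_trans (PBMO_osc_ge0 p gamma' delta' q' f x t L) _.
  by apply: ereal_sup_ubound; exists x, t, L.
move: (H x t L); case: (PBMO2_norm p gamma' delta' q' D f) => [v|_ _|//]; last first.
  by rewrite gt0_muley ?leey // lte_fin.
move=> {}H v0; apply/lee_addgt0Pr => e e0.
have eC : 0 < e / C by rewrite divr_gt0.
have := H (v + e / C) L0 _ RD _; rewrite lte_fin ltrDl eC => /(_ _ isT).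
rewrite mulrDr [C * (e / C)]mulrC divfK ?lt0r_neq0 // EFinD EFinM; apply.
by rewrite ltr_wpDl.
Qed.

End averages.

(** * Choice of the scale and of the thresholds *)

Section constants.
Context {R : realType}.

(** The second bound is where [1 < p] is decisive: it says [3 / b <= N^(p-1)], so that [N] links of
    duration of order [N^(-p)] fit into a gap of size [b]. *)
Lemma exists_scale (p b : R) : 1 < p -> 0 < b -> exists N : nat,
  [/\ (0 < N)%N, 2 < b * N%:R, 3 * N%:R <= b * N%:R `^ p & N%:R <= N%:R `^ p :> R].
Proof.
move=> p1 b0; pose y := Num.max (2 / b) ((3 / b) `^ (p - 1)^-1).
exists (Num.truncn y).+1; have yN := truncnS_gt y.
move: (Num.truncn y).+1 (ltn0Sn (Num.truncn y)) yN => N N0.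
rewrite /y gt_max => /andP[y1 y2].
have Nr : 0 < N%:R :> R by rewrite ltr0n.
have N1 : 1 <= N%:R :> R by rewrite ler1n.
split => //; first by rewrite mulrC -ltr_pdivrMr.
  have -> : N%:R `^ p = N%:R * N%:R `^ (p - 1) :> R.
    rewrite -[X in X * _](@powRr1 _ N%:R) ?ltW // -powRD; last by rewrite lt0r_neq0 ?implybT.
    by congr (_ `^ _); ring.
  have : 3 / b <= N%:R `^ (p - 1).
    have -> : 3 / b = ((3 / b) `^ (p - 1)^-1) `^ (p - 1).
      rewrite -powRrM mulVf ?powRr1 //; first by rewrite divr_ge0 // ltW.
      by rewrite lt0r_neq0 // subr_gt0.
    by apply: ge0_ler_powR; rewrite ?nnegrE ?powR_ge0 ?(ltW Nr) ?(ltW y2) // subr_ge0 ltW.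
  rewrite ler_pdivrMr // => H.
  have := ler_wpM2r (ltW Nr) H; lra.
by rewrite -[X in X <= _](@powRr1 _ N%:R) ?(ltW Nr) //; apply: (ler_powR N1); exact: ltW.
Qed.

Lemma exists_powRN_le (q e : R) : 0 < q -> 0 < e -> exists2 X : R, 0 < X & X `^ (- q) <= e.
Proof.
move=> q0 e0; exists (e `^ (- q^-1)); first exact: powR_gt0.
by rewrite -powRrM mulrNN mulVf ?lt0r_neq0 // powRr1 // ltW.
Qed.

End constants.

(** * Time reversal, and slabs against cells *)

Section parabolic_parts.
Context {R : realType} {n : nat}.
Local Notation ST := ('rV[R]_n * R)%type.
Local Notation mu := (@lebesgue_spacetime R n).
Implicit Types (x : 'rV[R]_n) (t L l p : R).

Lemma prectE p x t L : prect p x t L = full p false x L t.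
Proof. by apply/seteqP; split => -[y s] [/= xy]; rewrite ?in_itv /= => ?; split => //=; rewrite ?in_itv. Qed.

Lemma prect_upE p gamma x t L : prect_up p gamma x t L = upper p gamma false x L t.
Proof. by apply/seteqP; split => -[y s] [/= xy]; rewrite ?in_itv /= => ?; split => //=; rewrite ?in_itv. Qed.

Lemma prect_lowE p gamma x t L : prect_low p gamma x t L = lower p gamma false x L t.
Proof. by apply/seteqP; split => -[y s] [/= xy]; rewrite ?in_itv /= => ?; split => //=; rewrite ?in_itv. Qed.

Lemma slab_flip x l a b : slab true x l a b = slab false x l (- b) (- a).
Proof. by apply/seteqP; split => -[y s] [/= xy ?]; split => //=; lra. Qed.

Lemma full_flip p x l t : full p true x l t = full p false x l (- t).
Proof. by rewrite /full slab_flip; congr slab; lra. Qed.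

Lemma upper_flip p gamma x l t : upper p gamma true x l t = lower p gamma false x l (- t).
Proof. by rewrite /upper /lower slab_flip; congr slab; lra. Qed.

Lemma lower_flip p gamma x l t : lower p gamma true x l t = upper p gamma false x l (- t).
Proof. by rewrite /upper /lower slab_flip; congr slab; lra. Qed.

Lemma centre_flip p gamma q (g : ST -> R) x l t a : centre p gamma q false g x l t a ->
  centre p gamma q true (fun z => - g z) x l (- t) (- a).
Proof.
move=> ca lam lam0; have [H1 H2] := ca lam lam0.
rewrite upper_flip lower_flip opprK; split.
  rewrite (_ : [set z | _] = [set z | g z < a - lam]) //.
  by apply/seteqP; split => z /=; lra.
rewrite (_ : [set z | _] = [set z | a + lam < g z]) //.
by apply/seteqP; split => z /=; lra.
Qed.

(** Both sets lie in the closed box, whose measure equals that of the cell. *)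
Lemma slab_cell_null s x l a b : 0 <= l -> a <= b -> mu (slab s x l a b `\` cell s x l a b) = 0.
Proof.
move=> l0 ab.
pose A (i : 'I_n) : set R := `[x ord0 i - l, x ord0 i + l]%classic.
pose B : set R := if s then `[- b, - a]%classic else `[a, b]%classic.
have mA i : measurable (A i : set (measurableTypeR R)) by exact: measurable_itv.
have mB : measurable (B : set (measurableTypeR R)) by rewrite /B; case: (s); exact: measurable_itv.
have mbox : measurable (box A B : set (spacetime R n)).
  by apply: borel_measurable_spacetime; exact: borel_measurable_box.
have mu_box : mu (box A B) = ((2 * l) ^+ n * (b - a))%:E.
  rewrite lebesgue_box //.
  rewrite (eq_bigr (fun=> (2 * l)%:E)); last first.
    by move=> i _; rewrite lebesgue_itv_len; [congr EFin; lra|lra].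
  rewrite prodEFin prodr_const card_ord /B.
  by case: (s); (rewrite lebesgue_itv_len; last lra); rewrite -EFinM; congr (_ * _)%:E; lra.
have mC := measurable_cell s x l a b; have mS := measurable_slab s x l a b.
have CB : cell s x l a b `<=` box A B.
  move=> z [zx zt]; split=> [i|]; first by rewrite /A /= in_itv /=; have := zx i; lra.
  by move: zt; rewrite /B /otime; case: (s); rewrite /= in_itv /=; lra.
have SB : slab s x l a b `<=` box A B.
  move=> z [zx zt]; split=> [i|].
    by rewrite /A /= in_itv /=; have := zx i; rewrite ler_norml; lra.
  by move: zt; rewrite /B /otime; case: (s); rewrite /= in_itv /=; lra.
apply/eqP; rewrite eq_le measure_ge0 andbT.
apply: (@le_trans _ _ (mu (box A B `\` cell s x l a b))).
  apply: le_measure; rewrite ?inE; [exact: measurableD|exact: measurableD|].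
  exact: setSD.
rewrite measureD //; last by rewrite [X in (X < _)%E]mu_box ltry.
rewrite (setIidr CB) [X in (X - _)%E]mu_box [X in (_ - X)%E]lebesgue_cell // -EFinB.
by rewrite subrr.
Qed.

End parabolic_parts.

Section moments.
Context {R : realType} {n : nat}.
Local Notation ST := ('rV[R]_n * R)%type.
Local Notation mu := (@lebesgue_spacetime R n).
Implicit Types (x : 'rV[R]_n) (t L l p : R).

(** Levels spaced by [C + B] absorb the offset [C]: level [k + 1] lies above [a + C + k B]. The
    index lost is paid by the factor [eps^-1], which also covers level 0. *)
Lemma moment_of_decay s x l b1 b2 (g : ST -> R) (a C B r : R) :
  let eps := 2 `^ (- (r + 1)) in
  0 <= l -> b1 <= b2 -> measurable_fun setT (g : spacetime R n -> R) ->
  0 < r -> 0 <= C -> 0 < B ->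
  (forall k : nat, mu (cell s x l b1 b2 `&` [set z | a + C + k%:R * B < g z]%R) <=
     (eps ^+ k)%:E * mu (cell s x l b1 b2))%E ->
  (\int[mu]_(z in slab s x l b1 b2) (((fun w => g w - a)^\+ z) `^ r)%:E <=
    (2 * eps^-1 * (C + B) `^ r)%:E * mu (slab s x l b1 b2))%E.
Proof.
move=> eps l0 bb mg r0 C0 B0 decay.
have eps0 : 0 < eps by exact: powR_gt0.
have eps1 : 1 <= eps^-1.
  rewrite invf_ge1 // /eps powRN invf_le1 ?powR_gt0 //.
  have two1 : 1 <= 2 :> R by rewrite ler1n.
  have r1 : 0 <= r + 1 by lra.
  by have := ler_powR two1 r1; rewrite powRr0.
have mS := measurable_slab s x l b1 b2; have mC := measurable_cell s x l b1 b2.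
have fS : mu (slab s x l b1 b2) \is a fin_num by rewrite lebesgue_slab.
have muSC : mu (slab s x l b1 b2) = mu (cell s x l b1 b2).
  by rewrite lebesgue_slab // lebesgue_cell.
have mgt b : measurable ([set z | b < g z] : set (spacetime R n)).
  exact: measurable_superlevelT.
have decay' b k : a + C + k%:R * B <= b ->
    (mu (slab s x l b1 b2 `&` [set z | b < g z]%R) <= (eps ^+ k)%:E * mu (slab s x l b1 b2))%E.
  move=> hb; rewrite muSC; apply: le_trans (decay k).
  have mCk : measurable (cell s x l b1 b2 `&` [set z | a + C + k%:R * B < g z] : set (spacetime R n)).
    exact: measurableI.
  have mSC : measurable (slab s x l b1 b2 `\` cell s x l b1 b2 : set (spacetime R n)).
    exact: measurableD.
  rewrite -[leRHS]add0e -(slab_cell_null s x l0 bb); apply: le_trans (measureU2 _ mSC mCk).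
  apply: le_measure; rewrite ?inE; [exact: measurableI|exact: measurableU|].
  move=> z [Sz gz]; have [Cz|Cz] := pselect (cell s x l b1 b2 z); [right|by left].
  by split => //; exact: le_lt_trans gz.
have mga : measurable_fun (slab s x l b1 b2 : set (spacetime R n)) (fun w => g w - a).
  by apply: measurable_funB; [exact: measurable_funTS|exact: measurable_cst].
have CB0 : 0 < C + B by exact: ltr_wpDl.
apply: (@layer_cake _ _ _ mu _ (fun w => g w - a) r (C + B) eps^-1 mS fS mga r0 CB0 (le_trans ler01 eps1)).
move=> k; rewrite (_ : [set z | _] = [set z | a + k%:R * (C + B) < g z]); last first.
  by apply/seteqP; split => z /=; lra.
case: k => [|k].
  rewrite expr0 mulr1; apply: (@le_trans _ _ (1%:E * mu (slab s x l b1 b2))%E).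
    by rewrite mul1e; apply: le_measure; rewrite ?inE; [exact: measurableI|by []|exact: subIsetl].
  by apply: lee_wpmul2r.
apply: le_trans (decay' _ k _) _.
  rewrite -natr1; have : 0 <= k%:R * C by rewrite mulr_ge0.
  by lra.
by rewrite exprS mulKf // lt0r_neq0.
Qed.

Let scale_lt (M c lam y : R) : 0 < M -> (c / M + lam < y / M) = (lam * M < y - c).
Proof.
move=> M0; rewrite ltr_pdivlMr // mulrDl divfK ?lt0r_neq0 //.
by apply/idP/idP; lra.
Qed.

Let scale_gt (M c lam y : R) : 0 < M -> (y / M < c / M - lam) = (lam * M < c - y).
Proof.
move=> M0; rewrite ltr_pdivrMr // mulrBl divfK ?lt0r_neq0 //.
by apply/idP/idP; lra.
Qed.

Lemma PBMO_osc_centre (p gamma q M : R) (f h : ST -> R) x t l :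
  gamma < 1 -> 0 < q -> 0 < M -> 0 < l ->
  measurable_fun setT (h : spacetime R n -> R) ->
  (forall z, full p false x l t z -> h z = f z) ->
  upper p gamma false x l t `<=` full p false x l t ->
  lower p gamma false x l t `<=` full p false x l t ->
  (PBMO_osc p gamma gamma q f x t l < M%:E)%E ->
  exists a, centre p gamma q false (fun z => h z / M) x l t a.
Proof.
move=> g1 q0 M0 l0 mh hf UF LF /(PBMO_osc_lt q0 M0)[c []].
have mU : measurable (upper p gamma false x l t : set (spacetime R n)) by exact: measurable_slab.
have mL : measurable (lower p gamma false x l t : set (spacetime R n)) by exact: measurable_slab.
have lp := powR_gt0 p l0.
have m0 : 0 < (2 * l) ^+ n * ((1 - gamma) * l `^ p).
  by rewrite mulr_gt0 ?exprn_gt0 ?mulr_gt0 // subr_gt0.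
rewrite prect_upE prect_lowE.
move=> /(average_le_integral m0 (@mu_upper R n p gamma g1 false x l t l0)) intU.
move=> /(average_le_integral m0 (@mu_lower R n p gamma g1 false x l t l0)) intL.
exists (c / M) => lam lam0; split.
  rewrite (_ : [set z | _] = [set z | lam * M < h z - c]); last first.
    by apply/seteqP; split => z /=; rewrite scale_lt.
  apply: (@chebyshev_powR _ _ _ mu _ (fun z => h z - c) q M lam mU _ q0 M0 lam0).
    by apply: measurable_funB; [exact: measurable_funTS|exact: measurable_cst].
  apply: le_trans intU; rewrite le_eqVlt; apply/orP; left; apply/eqP.
  by apply: eq_integral => z; rewrite inE => /UF Uz; rewrite /funrpos hf.
rewrite (_ : [set z | _] = [set z | lam * M < c - h z]); last first.
  by apply/seteqP; split => z /=; rewrite scale_gt.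
apply: (@chebyshev_powR _ _ _ mu _ (fun z => c - h z) q M lam mL _ q0 M0 lam0).
  by apply: measurable_funB; [exact: measurable_cst|exact: measurable_funTS].
apply: le_trans intL; rewrite le_eqVlt; apply/orP; left; apply/eqP.
by apply: eq_integral => z; rewrite inE => /LF Lz; rewrite /funrpos /funrneg hf // opprB.
Qed.

End moments.

(** * The two comparisons *)

Section comparison.
Context {R : realType} {n : nat}.
Local Notation ST := ('rV[R]_n * R)%type.
Local Notation mu := (@lebesgue_spacetime R n).

Lemma measurable_cylinder (Omega : set 'rV[R]_n) (T : R) : open Omega ->
  measurable (cylinder Omega T : set (spacetime R n)).
Proof.
move=> oO; apply: borel_measurable_spacetime.
exact: borel_measurable_coord_open (coord_open_cylinder oO).
Qed.

Lemma funrneg_subC (f : ST -> R) c z : (fun w => f w - c)^\- z = (fun w => c - f w)^\+ z.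
Proof. by rewrite /funrpos /funrneg opprB. Qed.

(** The constant for the larger parts is reused; the fractions in the bound are the ratios of the
    measures of the parts. *)
Lemma PBMO_osc_compare (p gamma rho sigma q r : R) (D : set ST) (f : ST -> R) x t L M :
  0 < gamma -> gamma < 1 -> -1 < rho -> rho <= gamma -> - rho < sigma -> sigma <= gamma ->
  0 < q -> q <= r -> measurable (D : set (spacetime R n)) ->
  measurable_fun (D : set (spacetime R n)) (f : spacetime R n -> R) ->
  0 < L -> 0 < M -> prect p x t L `<=` D ->
  (PBMO2_norm p rho sigma r D f < M%:E)%E ->
  (PBMO_osc p gamma gamma q f x t L <=
    (((1 + (1 - rho) / (1 - gamma)) + (1 + (1 - sigma) / (1 - gamma))) `^ q^-1 * M)%:E)%E.
Proof.
move=> g0 g1 r1 rg s0 sg q0 qr mD mf L0 M0 RD normM.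
have r0 : 0 < r by exact: lt_le_trans qr.
have : (PBMO_osc p rho sigma r f x t L < M%:E)%E.
  by apply: le_lt_trans normM; apply: ereal_sup_ubound; exists x, t, L.
move=> /(PBMO_osc_lt r0 M0)[c []]; rewrite prect_upE prect_lowE.
have rho1 : rho < 1 by exact: le_lt_trans g1.
have sigma1 : sigma < 1 by exact: le_lt_trans g1.
have Lp := powR_gt0 p L0.
have vol (a : R) : a < 1 -> 0 < (2 * L) ^+ n * ((1 - a) * L `^ p).
  by move=> a1; rewrite mulr_gt0 ?exprn_gt0 ?mulr_gt0 // subr_gt0.
move=> /(average_le_integral (vol _ rho1) (@mu_upper R n p rho rho1 false x L t L0)) intU.
move=> /(average_le_integral (vol _ sigma1) (@mu_lower R n p sigma sigma1 false x L t L0)) intL.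
have rgL : rho * L `^ p <= gamma * L `^ p by rewrite ler_pM2r.
have sgL : sigma * L `^ p <= gamma * L `^ p by rewrite ler_pM2r.
have rL : - L `^ p < rho * L `^ p by rewrite -mulN1r ltr_pM2r.
have sL : - L `^ p < sigma * L `^ p by rewrite -mulN1r ltr_pM2r //; clear -s0 rg g1; lra.
have mU (a : R) : measurable (upper p a false x L t : set (spacetime R n)) by exact: measurable_slab.
have mL (a : R) : measurable (lower p a false x L t : set (spacetime R n)) by exact: measurable_slab.
have UD : upper p rho false x L t `<=` D.
  apply: subset_trans RD; rewrite prectE.
  by apply: slab_sub => [i||]; [by []|clear -rL; lra|by []].
have LD : lower p sigma false x L t `<=` D.
  apply: subset_trans RD; rewrite prectE.
  by apply: slab_sub => [i||]; [by []|by []|clear -sL; lra].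
have UU : upper p gamma false x L t `<=` upper p rho false x L t.
  by apply: slab_sub => [i||]; [by []|clear -rgL; lra|by []].
have LL : lower p gamma false x L t `<=` lower p sigma false x L t.
  by apply: slab_sub => [i||]; [by []|by []|clear -sgL; lra].
rewrite (_ : _ * M = ((1 + (1 - rho) / (1 - gamma)) * M `^ q +
    (1 + (1 - sigma) / (1 - gamma)) * M `^ q) `^ q^-1); last first.
  rewrite -mulrDl powRM ?powR_ge0 //; last first.
    have a1 : 0 <= (1 - rho) / (1 - gamma) by rewrite divr_ge0 // subr_ge0 ltW.
    have a2 : 0 <= (1 - sigma) / (1 - gamma) by rewrite divr_ge0 // subr_ge0 ltW.
    by lra.
  by rewrite -powRrM divff ?lt0r_neq0 // powRr1 // ltW.
have g1' : 1 - gamma != 0 by rewrite lt0r_neq0 // subr_gt0.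
have ratioU : (mu (upper p rho false x L t) =
    ((1 - rho) / (1 - gamma))%:E * mu (upper p gamma false x L t))%E.
  by rewrite !mu_upper // -EFinM; congr EFin; field.
have ratioL : (mu (lower p sigma false x L t) =
    ((1 - sigma) / (1 - gamma))%:E * mu (lower p gamma false x L t))%E.
  by rewrite !mu_lower // -EFinM; congr EFin; field.
apply: (@PBMO_osc_le R n p gamma gamma q _ _ c) => //.
  rewrite prect_upE; apply: (integral_le_average (vol _ g1) (@mu_upper R n p gamma g1 false x L t L0)).
  apply: (@power_mean_subset _ _ _ mu _ _ (fun w => f w - c) q r M _ (mU gamma) (mU rho) UU
      _ q0 qr M0 _ ratioU intU).
    by apply: measurable_funB; [exact: measurable_funS mf|exact: measurable_cst].
  by rewrite divr_ge0 // subr_ge0 ltW.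
rewrite prect_lowE; apply: (integral_le_average (vol _ g1) (@mu_lower R n p gamma g1 false x L t L0)).
under eq_integral do rewrite funrneg_subC.
have {}intL : (\int[mu]_(z in lower p sigma false x L t) ((fun w => c - f w)^\+ z `^ r)%:E
    <= (M `^ r)%:E * mu (lower p sigma false x L t))%E.
  by apply: le_trans intL; under [leRHS]eq_integral do rewrite funrneg_subC.
apply: (@power_mean_subset _ _ _ mu _ _ (fun w => c - f w) q r M _ (mL gamma) (mL sigma) LL
    _ q0 qr M0 _ ratioL intL).
  by apply: measurable_funB; [exact: measurable_cst|exact: measurable_funS mf].
by rewrite divr_ge0 // subr_ge0 ltW.
Qed.

End comparison.

Section reverse_comparison.
Context {R : realType} {n : nat}.
Local Notation ST := ('rV[R]_n * R)%type.
Local Notation mu := (@lebesgue_spacetime R n).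

Let average_scaled_le (E : set ST) (u v : ST -> R) (M r K m : R) :
  measurable (E : set (spacetime R n)) -> 0 < m -> mu E = m%:E ->
  measurable_fun setT (v : spacetime R n -> R) -> 0 < M ->
  (forall z, E z -> u z = M * v z) ->
  (\int[mu]_(z in E) ((v^\+ z) `^ r)%:E <= K%:E * mu E)%E ->
  (average E (fun z => ((u^\+ z) `^ r)%:E) <= (K * M `^ r)%:E)%E.
Proof.
move=> mE m0 muE mv M0 uv intv; apply: (integral_le_average m0 muE).
have mEv : measurable_fun (E : set (spacetime R n)) (v : spacetime R n -> R).
  exact: measurable_funTS.
rewrite (integral_scale_powR mu r mE mEv M0 uv) mulrC EFinM -muleA.
by apply: lee_wpmul2l intv; rewrite lee_fin powR_ge0.
Qed.

Let powR_double (K M r : R) : 0 < r -> 0 <= K -> 0 <= M ->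
  (K + K) `^ r^-1 * M = (K * M `^ r + K * M `^ r) `^ r^-1.
Proof.
move=> r0 K0 M0; rewrite -mulrDl powRM ?powR_ge0 ?addr_ge0 //.
by rewrite -powRrM divff ?lt0r_neq0 // powRr1.
Qed.

Let full_shrink (p mid : R) (N : nat) (x : 'rV[R]_n) (L t : R) : (0 < N)%N -> 0 < L ->
  2 <= (1 + mid) * N%:R `^ p -> 2 <= (1 - mid) * N%:R `^ p ->
  full p false x (L / N%:R) (t + mid * L `^ p) `<=` full p false x L t.
Proof.
move=> N0 L0 h1 h2; have Nr : 0 < N%:R :> R by rewrite ltr0n.
have LN : 0 < L / N%:R by rewrite divr_gt0.
have lp := powR_gt0 p LN.
have LNp : N%:R `^ p * (L / N%:R) `^ p = L `^ p.
  by rewrite powR_div ?(ltW L0) // mulrC divfK // lt0r_neq0 // powR_gt0.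
have LNL : L / N%:R <= L by rewrite ler_pdivrMr // ler_peMr ?(ltW L0) // ler1n.
have {}h1 : 2 * (L / N%:R) `^ p <= (1 + mid) * L `^ p by rewrite -LNp mulrA ler_pM2r.
have {}h2 : 2 * (L / N%:R) `^ p <= (1 - mid) * L `^ p by rewrite -LNp mulrA ler_pM2r.
by apply: slab_sub => [i||]; [split; lra|lra|lra].
Qed.

Lemma PBMO_osc_reverse (p gamma rho sigma q r : R) :
  1 < p -> 0 < gamma -> gamma < 1 -> -1 < rho -> rho <= gamma ->
  - rho < sigma -> sigma <= gamma -> 0 < q -> q <= r ->
  exists2 C : R, 0 < C & forall (D : set ST) (f : ST -> R) x t L M,
  measurable (D : set (spacetime R n)) ->
  measurable_fun (D : set (spacetime R n)) (f : spacetime R n -> R) ->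
  0 < L -> 0 < M -> prect p x t L `<=` D ->
  (PBMO2_norm p gamma gamma q D f < M%:E)%E ->
  (PBMO_osc p rho sigma r f x t L <= (C * M)%:E)%E.
Proof.
move=> p1 g0 g1 r1 rg s0 sg q0 qr.
have p0 : 0 < p by exact: lt_trans p1.
have r0 : 0 < r by exact: lt_le_trans qr.
(* Halfway between the lower part, ending at height [- sigma], and the upper part, starting at
   [rho]. *)
pose mid := (rho - sigma) / 2.
(* All margins that must be large compared with the scale, so that a single choice of [N] serves
   both time directions. *)
pose b := Num.min ((1 - gamma) / 2) (Num.min (1 + rho) (Num.min (1 + sigma)
  (Num.min ((rho + sigma) / 2) (Num.min (1 + mid) (1 - mid))))).
have b0 : 0 < b by rewrite /b /mid !lt_min; do !(apply/andP; split); lra.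
have [N [N0 bN bP NP]] := exists_scale p1 b0.
have : b <= b by []; rewrite {2}/b !le_min => /and5P[b1 b2 b3 b4 /andP[b5 b6]].
have Nr : 0 < N%:R :> R by rewrite ltr0n.
have P0 : 0 < N%:R `^ p :> R by exact: powR_gt0.
have bNP : b * N%:R <= b * N%:R `^ p by rewrite ler_pM2l.
have P2 : 2 < b * N%:R `^ p by exact: lt_le_trans bNP.
have beta_P : 2 < (1 - gamma) / 2 * N%:R `^ p by apply: lt_le_trans P2 _; rewrite ler_pM2r.
have N4 : 4 <= (1 - gamma) * N%:R.
  have : b * N%:R <= (1 - gamma) / 2 * N%:R by rewrite ler_pM2r.
  by lra.
have rhoP : 2 <= (1 + rho) * N%:R `^ p by apply: le_trans (ltW P2) _; rewrite ler_pM2r.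
have sigmaP : 2 <= (1 + sigma) * N%:R `^ p by apply: le_trans (ltW P2) _; rewrite ler_pM2r.
have thetaP : 3 * N%:R <= (rho + sigma) / 2 * N%:R `^ p.
  by apply: le_trans bP _; rewrite ler_pM2r.
have midP : 2 <= (1 + mid) * N%:R `^ p by apply: le_trans (ltW P2) _; rewrite ler_pM2r.
have midP' : 2 <= (1 - mid) * N%:R `^ p by apply: le_trans (ltW P2) _; rewrite ler_pM2r.
pose eps : R := 2 `^ (- (r + 1)).
have eps0 : 0 < eps by exact: powR_gt0.
pose S := @subcell_ratio R n p N * (@packing_ratio R n gamma * 2 * 4).
have S0 : 0 <= S.
  rewrite !mulr_ge0 ?exprn_ge0 ?addr_ge0 ?powR_ge0 //.
  by rewrite invr_ge0 subr_ge0 ltW.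
have S1 : 0 < S + 1 by rewrite ltr_wpDl.
(* The second bound gives [S * (A / 2)^(-q) <= eps]; [S + 1] replaces [S] to divide by a positive
   number. *)
have [A' A'0 A'le] : exists2 X : R, 0 < X & X `^ (- q) <= Num.min 2^-1 (eps / (S + 1)).
  by apply: exists_powRN_le => //; rewrite lt_min divr_gt0 // invr_gt0 ltr0n.
have [Lam Lam0 Lamle] : exists2 X : R, 0 < X & X `^ (- q) <= 8^-1.
  by apply: exists_powRN_le => //; rewrite invr_gt0 ltr0n.
have n2 : 0 < 4 * 2 ^+ n :> R by rewrite mulr_gt0 ?exprn_gt0.
have [Kap Kap0 Kaple] : exists2 X : R, 0 < X & X `^ (- q) <= 2^-1 / (4 * 2 ^+ n).
  by apply: exists_powRN_le => //; rewrite divr_gt0 // invr_gt0 ltr0n.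
have {}Kaple : Kap `^ (- q) * (4 * 2 ^+ n) < 1.
  by move: Kaple; rewrite ler_pdivlMr // => H; apply: le_lt_trans H _; lra.
pose A := 2 * A'.
have A0 : 0 < A by rewrite mulr_gt0.
have A2 : A / 2 = A' by rewrite /A; field.
move: A'le; rewrite le_min -A2 => /andP[A2le Aeps].
have {}Aeps : @subcell_ratio R n p N *
    (@packing_ratio R n gamma * 2 * ((A / 2) `^ (- q) * 4)) <= eps.
  have -> : @subcell_ratio R n p N * (@packing_ratio R n gamma * 2 * ((A / 2) `^ (- q) * 4))
     = S * (A / 2) `^ (- q) by rewrite /S; ring.
  have := powR_ge0 (A / 2) (- q); move: Aeps; rewrite ler_pdivlMr //.
  by move: ((A / 2) `^ (- q)) => v; lra.
pose C0 := (2 * N%:R `^ p + 1) * (2 * Kap).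
have C00 : 0 <= C0 by rewrite !mulr_ge0 ?addr_ge0 ?mulr_ge0 ?(ltW P0) ?(ltW Kap0).
pose B := A + Lam.
have B0 : 0 < B by rewrite addr_gt0.
pose Cm := 2 * eps^-1 * (C0 + B) `^ r.
have Cm0 : 0 < Cm by rewrite !mulr_gt0 ?invr_gt0 ?powR_gt0 // ltr_wpDl.
exists ((Cm + Cm) `^ r^-1); first by rewrite powR_gt0 // addr_gt0.
move=> D f x t L M mD mf L0 M0 RD normM.
have Lp := powR_gt0 p L0.
pose R0 : set ST := full p false x L t.
have R0D : R0 `<=` D by rewrite /R0 -prectE.
have mR0 : measurable (R0 : set (spacetime R n)) by exact: measurable_slab.
(* Extension by zero outside the rectangle makes the function measurable everywhere; every rectangle
   used below lies in [R0]. *)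
pose h : spacetime R n -> R := (f : spacetime R n -> R) \_ (R0 : set (spacetime R n)).
have mh : measurable_fun setT h.
  by apply/(measurable_restrictT _ mR0); exact: measurable_funS mf.
have hf z : R0 z -> h z = f z by move=> Rz; rewrite /h patchE mem_set.
pose g : ST -> R := fun z => h z / M.
have mg : measurable_fun setT (g : spacetime R n -> R).
  by apply: measurable_funM.
have centreF y l u : 0 < l -> full p false y l u `<=` R0 ->
    exists a, centre p gamma q false g y l u a.
  move=> l0 yR.
  apply: (PBMO_osc_centre (f := f)) => //.
  - by move=> z /yR /hf.
  - by apply: upper_full => //; exact: ltW.
  - by apply: lower_full => //; exact: ltW.
  apply: le_lt_trans normM; apply: ereal_sup_ubound; exists y, u, l; split => //.
  by rewrite prectE; exact: subset_trans R0D.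
have centreT y l u : 0 < l -> full p true y l u `<=` full p true x L (- t) ->
    exists a, centre p gamma q true (fun z => - g z) y l u a.
  rewrite !full_flip opprK => l0 yR; have [a ca] := centreF y l (- u) l0 yR.
  by exists (- a); rewrite -[u]opprK; exact: centre_flip.
have N1 : 1 <= N%:R :> R by rewrite ler1n.
have LN : 0 < L / N%:R by rewrite divr_gt0.
have [a ca] : exists a, centre p gamma q false g x (L / N%:R) (t + mid * L `^ p) a.
  apply: centreF => //.
  exact: full_shrink.
have one2 : 1 <= 2 :> R by rewrite ler1n.
have rho_mid : 3 * N%:R <= (rho - mid) * N%:R `^ p.
  by have -> : rho - mid = (rho + sigma) / 2 by rewrite /mid; field.
have sigma_mid : 3 * N%:R <= (sigma - - mid) * N%:R `^ p.
  by have -> : sigma - - mid = (rho + sigma) / 2 by rewrite /mid; field.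
have decayU k := @upper_decay R n p gamma q N false g x L t rho mid A Lam eps Kap a k
  p0 g0 g1 N0 beta_P N4 rg rhoP rho_mid (le_trans one2 midP) A0 Lam0 A2le Lamle Aeps Kap0 Kaple mg L0
  centreF ca.
have ca' : centre p gamma q true (fun z => - g z) x (L / N%:R) (- t + - mid * L `^ p) (- a).
  have -> : - t + - mid * L `^ p = - (t + mid * L `^ p) by ring.
  exact: centre_flip.
have mNg : measurable_fun setT ((fun z => - g z) : spacetime R n -> R).
  exact: measurableT_comp.
(* Reversal turns the lower part into an upper one and moves the reference rectangle to height
   [- mid]; its centre becomes [- a], so both estimates concern the same constant. *)
have decayL k := @upper_decay R n p gamma q N true (fun z => - g z) x L (- t) sigma (- mid) A Lam eps Kap (- a) k
  p0 g0 g1 N0 beta_P N4 sg sigmaP sigma_mid (le_trans one2 midP') A0 Lam0 A2le Lamle Aeps Kap0 Kaple mNg L0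
  centreT ca'.
have rL : t + rho * L `^ p <= t + L `^ p by rewrite lerD2l ler_piMl ?(ltW Lp) //; exact: le_trans (ltW g1).
have sL : - t + sigma * L `^ p <= - t + L `^ p by rewrite lerD2l ler_piMl ?(ltW Lp) //; exact: le_trans (ltW g1).
have momU := moment_of_decay (ltW L0) rL mg r0 C00 B0 decayU.
have momL := moment_of_decay (ltW L0) sL mNg r0 C00 B0 decayL.
have upper_R0 : upper p rho false x L t `<=` R0.
  apply: slab_sub => [i||]; [by []| |by []].
  by rewrite lerD2l -mulN1r ler_pM2r // ltW.
have lower_R0 : upper p sigma true x L (- t) `<=` R0.
  rewrite /R0 -[t]opprK -full_flip opprK.
  apply: slab_sub => [i||]; [by []| |by []].
  rewrite lerD2l -mulN1r ler_pM2r // ltW //.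
  by apply: le_lt_trans s0; rewrite lerN2 (le_trans rg) // ltW.
have gf z : R0 z -> f z = M * g z.
  by move=> Rz; rewrite /g hf // mulrC divfK // lt0r_neq0.
have rho1 : rho < 1 by exact: le_lt_trans g1.
have sigma1 : sigma < 1 by exact: le_lt_trans g1.
have vol (d : R) : d < 1 -> 0 < (2 * L) ^+ n * ((1 - d) * L `^ p).
  by move=> d1; rewrite mulr_gt0 ?exprn_gt0 ?mulr_gt0 // subr_gt0.
have -> : (Cm + Cm) `^ r^-1 * M = (Cm * M `^ r + Cm * M `^ r) `^ r^-1.
  by apply: powR_double; rewrite ?(ltW Cm0) ?(ltW M0).
apply: (PBMO_osc_le (c := M * a)) => //.
  rewrite prect_upE; apply: (average_scaled_le (v := fun w => g w - a) _
    (vol _ rho1) (@mu_upper R n p rho rho1 false x L t L0) _ M0 _ momU).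
  - exact: measurable_slab.
  - by apply: measurable_funB => //; exact: measurable_cst.
  - move=> z Uz; rewrite gf ?mulrBr //; exact: upper_R0.
rewrite prect_lowE.
have -> : (fun z => (((fun w => f w - M * a)^\- z) `^ r)%:E) =
    (fun z => (((fun w => M * a - f w)^\+ z) `^ r)%:E).
  by apply/funext => z; rewrite funrneg_subC.
rewrite -[t]opprK -upper_flip opprK in momL *.
apply: (average_scaled_le (v := fun w => - g w - - a) _
    (vol _ sigma1) (@mu_upper R n p sigma sigma1 true x L (- t) L0) _ M0 _ momL).
- exact: measurable_slab.
- by apply: measurable_funB => //; exact: measurable_cst.
- move=> z Uz; rewrite gf; last exact: lower_R0.
  by ring.
Qed.

End reverse_comparison.

Unset Implicit Arguments.
Set Strict Implicit.

Theorem corollary4p2 (R : realType) (n : nat) (p gamma rho sigma q r : R)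
  (n_ge1 : (1 <= n)%N) (p_gt1 : 1 < p)
  (gamma_gt0 : 0 < gamma) (gamma_lt1 : gamma < 1)
  (rho_gtN1 : -1 < rho) (rho_le : rho <= gamma)
  (sigma_gt : - rho < sigma) (sigma_le : sigma <= gamma)
  (q_gt0 : 0 < q) (q_le_r : q <= r) :
  exists c1 c2 : R, [/\ 0 < c1, 0 < c2 &
    forall (Omega : set 'rV[R]_n) (T : R) (f : 'rV[R]_n * R -> R),
      domain Omega -> 0 < T -> Lq_loc q (cylinder Omega T) f ->
      (c1%:E * PBMO_norm p gamma q (cylinder Omega T) f
         <= PBMO2_norm p rho sigma r (cylinder Omega T) f)%E /\
      (PBMO2_norm p rho sigma r (cylinder Omega T) f
         <= c2%:E * PBMO_norm p gamma q (cylinder Omega T) f)%E].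
Proof.
have [c2 c2_gt0 H2] := @PBMO_osc_reverse R n p gamma rho sigma q r p_gt1 gamma_gt0 gamma_lt1 rho_gtN1 rho_le
  sigma_gt sigma_le q_gt0 q_le_r.
pose c1 := (1 + (1 - rho) / (1 - gamma) + (1 + (1 - sigma) / (1 - gamma))) `^ q^-1.
have c1_gt0 : 0 < c1.
  have a1 : 0 <= (1 - rho) / (1 - gamma).
    by rewrite divr_ge0 // subr_ge0 ?(le_trans rho_le) // ltW.
  have a2 : 0 <= (1 - sigma) / (1 - gamma).
    by rewrite divr_ge0 // subr_ge0 ?(le_trans sigma_le) // ltW.
  by apply: powR_gt0; lra.
exists c1^-1, c2; split => //; first by rewrite invr_gt0.
move=> Omega T f [_ openOmega _] _ [mf _].
have mOT := measurable_cylinder T openOmega.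
split; last by apply: PBMO2_norm_le => // x t L M L0 M0 RD; exact: H2.
rewrite lee_pdivrMl //; apply: PBMO2_norm_le => // x t L M L0 M0 RD.
exact: PBMO_osc_compare.
Qed.
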